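(* Let $\mathbf{C}$ be a category of $\mathbf{FI}$ type and consider (finitely generated) free $\mathbf{C}$-modules over $\mathbb{C}$. Then: (1) if $M_\bullet,N_\bullet$ are free, the tensor product $(M\otimes N)_\bullet$, $d\mapsto M_d\otimes N_d$ (morphisms acting by $M(f)\otimes N(f)$), is free; moreover if $M_\bullet$ has degree $\leq c_1$ and $N_\bullet$ has degree $\leq c_2$ then $M\otimes N$ has degree $\leq c_1+c_2$. (2) For a free module $M_\bullet=\bigoplus_i\mathrm{Ind}_{c_i}(V_i)$, its dual $M^*_\bullet:=\bigoplus_i\mathrm{Ind}_{c_i}(V_i^* )$ is free of the same degree, and there is a homomorphism of $\mathbf{C}$-modules $M^*\otimes M\to\mathbb{C}_\bullet$ (the constant module with value $\mathbb{C}$ and identity maps) which is a non-degenerate pairing at each object $d$, hence defines a $G_d$-equivariant isomorphism $(M^* )_d\cong (M_d)^*$ for every $d$. (3) If $M_\bullet$ is free of degree $\leq c$, then for all objects $c\leq d\leq e$ the map of coinvariants $M_d/G_d\to M_e/G_e$ induced by any morphism $d\to e$ is an isomorphism.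
   Context: A category $\mathbf{C}$ is of $\mathbf{FI}$ type if: (1) all Hom-sets are finite; (2) every morphism is a monomorphism and every endomorphism is an isomorphism; (3) for all objects $c,d$ the group $G_d=\mathrm{Aut}_{\mathbf{C}}(d)$ acts transitively on $\mathrm{Hom}_{\mathbf{C}}(c,d)$; (4) for every $d$ there are only finitely many isomorphism classes of objects $c$ with $\mathrm{Hom}_{\mathbf{C}}(c,d)\neq\emptyset$; (5) every pair $c_1\to d\leftarrow c_2$ has a pullback, and every pair $f_i:p\to c_i$ has a weak push-out, i.e. a commutative square $g_i:c_i\to d$ ($g_1f_1=g_2f_2$) which is a pullback square and such that for every other pullback square $h_i:c_i\to z$ with $h_1f_1=h_2f_2$ there is a unique $h:d\to z$ with $hg_i=h_i$. Write $c\leq d$ if $\mathrm{Hom}(c,d)\neq\emptyset$; $G_c=\mathrm{Aut}(c)$. A $\mathbf{C}$-module is a functor from $\mathbf{C}$ to complex vector spaces. For a finite-dimensional $G_c$-representation $V$, $\mathrm{Ind}_c(V)$ is $d\mapsto\mathbb{C}[\mathrm{Hom}(c,d)]\otimes_{\mathbb{C}[G_c]}V$. A free module is a finite direct sum of induction modules; it has degree $\leq d$ if every $\mathrm{Ind}_c(V)$ appearing nontrivially has $c\leq d$. For objects $c_1,c_2$, write $d\geq c_1+c_2$ if $w\leq d$ for every weak push-out object $w$ of any pair of morphisms $p\to c_1$, $p\to c_2$; a free module has degree $\leq c_1+c_2$ if it has degree $\leq d$ for every $d\geq c_1+c_2$. Coinvariants: $V/G=V/\langle v-gv\rangle$. 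*)

(* Defs.v *)
(* Complex numbers are modelled as R[i] for R : realType
   (mathcomp-real-closed's [complex], R is a real-closed field). *)
From HB Require Import structures.
From mathcomp Require Import all_boot all_algebra.
From mathcomp Require Import reals.
From mathcomp Require Import complex mxtens.
From Stdlib Require List.

Set Implicit Arguments.
Unset Strict Implicit.
Unset Printing Implicit Defensive.
Import GRing.Theory.
Local Open Scope ring_scope.

(* Categories with finite Hom-sets (condition (1) of FI type is built in:     *)
(* Hom-sets are finTypes).                                                    *)
Record category := Category {
  ob :> Type;
  Mor : ob -> ob -> finType;
  idm : forall a, Mor a a;
  mcomp : forall a b c, Mor b c -> Mor a b -> Mor a c;
  comp1m : forall a b (f : Mor a b), mcomp (idm b) f = f;
  compm1 : forall a b (f : Mor a b), mcomp f (idm a) = f;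
  compA : forall a b c e (h : Mor c e) (g : Mor b c) (f : Mor a b),
      mcomp h (mcomp g f) = mcomp (mcomp h g) f
}.
Arguments Mor {_} a b.
Arguments idm {_} a.
Arguments mcomp {_ a b c} g f.

Section FItype.
Variable C : category.

Definition is_iso (a b : C) (f : Mor a b) : Prop :=
  exists g : Mor b a, mcomp g f = idm a /\ mcomp f g = idm b.

(* boolean version, used to range over G_d = Aut(d) in sums *)
Definition isAut (d : C) (g : Mor d d) : bool :=
  [exists g' : Mor d d, (mcomp g' g == idm d) && (mcomp g g' == idm d)].

Definition iso_obj (a b : C) : Prop := exists f : Mor a b, is_iso f.

Definition le_ob (c d : C) : Prop := inhabited (Mor c d).

Definition is_pullback (p c1 c2 d : C) (p1 : Mor p c1) (p2 : Mor p c2)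
    (g1 : Mor c1 d) (g2 : Mor c2 d) : Prop :=
  mcomp g1 p1 = mcomp g2 p2 /\
  forall (z : C) (z1 : Mor z c1) (z2 : Mor z c2), mcomp g1 z1 = mcomp g2 z2 ->
    exists! h : Mor z p, mcomp p1 h = z1 /\ mcomp p2 h = z2.

Definition is_weak_pushout (p c1 c2 d : C) (f1 : Mor p c1) (f2 : Mor p c2)
    (g1 : Mor c1 d) (g2 : Mor c2 d) : Prop :=
  is_pullback f1 f2 g1 g2 /\
  forall (z : C) (h1 : Mor c1 z) (h2 : Mor c2 z), is_pullback f1 f2 h1 h2 ->
    exists! h : Mor d z, mcomp h g1 = h1 /\ mcomp h g2 = h2.

Definition FI_type : Prop :=
  (forall (a b c : C) (f : Mor b c) (g h : Mor a b), mcomp f g = mcomp f h -> g = h) /\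
  (forall (a : C) (f : Mor a a), is_iso f) /\
  (forall (c d : C) (f g : Mor c d), exists s : Mor d d, is_iso s /\ mcomp s f = g) /\
  (forall d : C, exists s : seq C, forall c : C, le_ob c d ->
       exists2 c', List.In c' s & iso_obj c c') /\
  (forall (c1 c2 d : C) (g1 : Mor c1 d) (g2 : Mor c2 d),
      exists (p : C) (p1 : Mor p c1) (p2 : Mor p c2), is_pullback p1 p2 g1 g2) /\
  (forall (p c1 c2 : C) (f1 : Mor p c1) (f2 : Mor p c2),
      exists (d : C) (g1 : Mor c1 d) (g2 : Mor c2 d), is_weak_pushout f1 f2 g1 g2).

Definition geq_sum (c1 c2 d : C) : Prop :=
  forall (p w : C) (f1 : Mor p c1) (f2 : Mor p c2) (g1 : Mor c1 w) (g2 : Mor c2 w),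
    is_weak_pushout f1 f2 g1 g2 -> le_ob w d.

End FItype.

(* C-modules (pointwise finite dimensional), over a field K.                 *)
(* M_d = row vectors 'rV_(mdim d); a morphism f : c -> d acts by             *)
(* v |-> v *m mact f.                                                         *)
Section Modules.
Variables (C : category) (K : fieldType).

Record cmod := CMod {
  mdim : C -> nat;
  mact : forall c d : C, Mor c d -> 'M[K]_(mdim c, mdim d)
}.
Arguments mact : clear implicits.
Arguments mact M {c d} f : rename.

Definition is_mhom (M N : cmod) (phi : forall d : C, 'M[K]_(mdim M d, mdim N d)) : Prop :=
  forall (c d : C) (f : Mor c d), mact M f *m phi d = phi c *m mact N f.

Definition mod_iso (M N : cmod) : Prop :=
  exists phi : forall d : C, 'M[K]_(mdim M d, mdim N d),
    @is_mhom M N phi /\ forall d : C, row_free (phi d) && row_full (phi d).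

Definition zero_mod : cmod := @CMod (fun _ => 0%N) (fun c d _ => 0).

Definition const_mod : cmod := @CMod (fun _ => 1%N) (fun c d _ => 1%:M).

Definition dsum_mod (M N : cmod) : cmod :=
  @CMod (fun d => mdim M d + mdim N d)%N
        (fun c d f => block_mx (mact M f) 0 0 (mact N f)).

Definition tens_mod (M N : cmod) : cmod :=
  @CMod (fun d => mdim M d * mdim N d)%N
        (fun c d f => mact M f *t mact N f).

(* quotient of 'rV_n by the row space of U: the linear surjection
   v |-> v *m quot_map U  has kernel exactly U (cf. submxE, mulmx_base) *)
Definition quot_map (n m : nat) (U : 'M[K]_(m, n)) :
    'M[K]_(n, \rank (cokermx U)) := col_base (cokermx U).

(* a finite dimensional representation V = 'rV_sdim of G_c, c = sob;
   g acts by v |-> v *m srep g *)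
Record summand := Summand {
  sob : C;
  sdim : nat;
  srep : Mor sob sob -> 'M[K]_sdim
}.
Arguments srep : clear implicits.

Definition is_rep (s : summand) : Prop :=
  srep s (idm (sob s)) = 1%:M /\
  forall g h : Mor (sob s) (sob s), isAut g -> isAut h ->
     srep s (mcomp h g) = srep s g *m srep s h.

Definition hvec (c d : C) (f : Mor c d) : 'rV[K]_#|Mor c d| :=
  delta_mx 0 (enum_rank f).

(* ambient space C[Hom(c,d)] (x)_C V  = 'rV_(#|Hom(c,d)| * sdim) *)
(* relations  (f o g) (x) v  -  f (x) g.v ,  f in Hom(c,d), g in G_c *)
Definition ind_rel (s : summand) (d : C) :
    'M[K]_(#|Mor (sob s) d| * sdim s) :=
  (\sum_(f : Mor (sob s) d) \sum_(g : Mor (sob s) (sob s) | isAut g)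
     <<hvec (mcomp f g) *t (1%:M : 'M[K]_(sdim s)) - hvec f *t srep s g>>)%MS.

Definition hpush (c d e : C) (h : Mor d e) : 'M[K]_(#|Mor c d|, #|Mor c e|) :=
  \matrix_(i, j) ((mcomp h (enum_val i) == enum_val j)%:R).

(* Ind_c(V)_d = C[Hom(c,d)] (x)_{C[G_c]} V *)
Definition ind_dim (s : summand) (d : C) : nat := \rank (cokermx (ind_rel s d)).

Definition ind_act (s : summand) (d e : C) (h : Mor d e) :
    'M[K]_(ind_dim s d, ind_dim s e) :=
  pinvmx (quot_map (ind_rel s d))
   *m (hpush (sob s) h *t (1%:M : 'M[K]_(sdim s)))
   *m quot_map (ind_rel s e).

Definition Ind (s : summand) : cmod := @CMod (ind_dim s) (@ind_act s).

Definition free_mod (F : seq summand) : cmod :=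
  foldr (fun s M => dsum_mod (Ind s) M) zero_mod F.

Definition reps (F : seq summand) : Prop := List.Forall is_rep F.

Definition deg_le (F : seq summand) (d : C) : Prop :=
  List.Forall (fun s => (0 < sdim s)%N -> le_ob (sob s) d) F.

Definition deg_le_sum (F : seq summand) (c1 c2 : C) : Prop :=
  forall d : C, geq_sum c1 c2 d -> deg_le F d.

(* dual representation  g |-> rho(g^-1)^T = (rho(g)^-1)^T *)
Definition dual_summand (s : summand) : summand :=
  @Summand (sob s) (sdim s) (fun g => (invmx (srep s g))^T).

Definition dual_free (F : seq summand) : seq summand := map dual_summand F.

Definition pairing (m n : nat) (Phi : 'M[K]_(m * n, 1)) (x : 'rV[K]_m) (y : 'rV[K]_n) : K :=
  \sum_(i < m) \sum_(j < n) x 0 i * y 0 j * Phi (mxtens_index (i, j)) 0.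

Definition coinv_rel (M : cmod) (d : C) : 'M[K]_(mdim M d) :=
  (\sum_(g : Mor d d | isAut g) <<1%:M - mact M g>>)%MS.

Definition coinv_map (M : cmod) (d e : C) (h : Mor d e) :=
  pinvmx (quot_map (coinv_rel M d)) *m mact M h *m quot_map (coinv_rel M e).

End Modules.
Arguments is_mhom {C K} M N phi.
Arguments mod_iso {C K} M N.
Arguments const_mod C K.
Arguments coinv_map {C K} M {d e} h.

(* Main.v *)
(* Call a frame of M over a family of representations V_i of G_{c_i} the
   coordinate data of an isomorphism M = (+)_i Ind_{c_i}(V_i): maps
   inc_f : V_i -> M_d, v |-> f (x) v, natural in d, and prj_f : M_d -> V_i, for
   all f in Hom(c_i, d), subject to two identities: inc_f prj_f' is the sum of
   the g in G_{c_i} with f = f' g, and the prj_f inc_f, weighted by 1/|G_{c_i}|,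
   sum up to the identity (G_{c_i} acts freely on Hom(c_i, d), as morphisms are
   monic). The inc_f jointly determine linear maps out of M_d, so modules with
   frames over the same family are isomorphic.

   Tensor products: each pair (x, y) in Hom(c_i, d) x Hom(c_j, d) is uniquely,
   up to G_w, of the form (h a, h b) with (a, b) the legs of a weak push-out w
   (push out the pullback of x and y). On (M (x) N)_w the legs of weak push-outs
   with vertex w span the image of an idempotent, a representation of G_w; these
   representations, one for each isomorphism class of w, form a frame of M (x) N.

   Duals: the form with matrix \sum_f 1/|G_{c_i}| prj*_f (prj_f)^T is inverted by
   \sum_f 1/|G_{c_i}| (inc_f)^T inc*_f.

   Coinvariants: as G_d is transitive on Hom(c_i, d), all the inc_f with
   f in Hom(c_i, d) agree modulo G_d with their average A_{i,d}, and
   \sum_f 1/|G_{c_i}| prj_f A_{i,d}, over the f in Hom(c_i, e), induces the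
   inverse of M_d/G_d -> M_e/G_e. *)
Require Import Defs.
From HB Require Import structures.
From mathcomp Require Import all_boot all_algebra.
From mathcomp Require Import reals.
From mathcomp Require Import complex mxtens.
From mathcomp Require Import boolp.
From Stdlib Require List.
Set Implicit Arguments.
Unset Strict Implicit.
Unset Printing Implicit Defensive.
Import GRing.Theory.
Local Open Scope ring_scope.

(** * Tensor products, quotients and idempotents of matrices *)

Section LinearAlgebra.
Variable K : fieldType.

Lemma tensmxDl m n p q (A A' : 'M[K]_(m, n)) (B : 'M[K]_(p, q)) :
  (A + A') *t B = A *t B + A' *t B.
Proof.
by apply/matrixP => i j; rewrite !mxE mulrDl.
Qed.

Lemma tensmxDr m n p q (A : 'M[K]_(m, n)) (B B' : 'M[K]_(p, q)) :
  A *t (B + B') = A *t B + A *t B'.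
Proof.
by apply/matrixP => i j; rewrite !mxE mulrDr.
Qed.

Lemma tensmxZ m n p q (a b : K) (A : 'M[K]_(m, n)) (B : 'M[K]_(p, q)) :
  (a *: A) *t (b *: B) = (a * b) *: (A *t B).
Proof. by apply/matrixP => i j; rewrite !mxE mulrACA. Qed.

Lemma tensmx_suml m n p q (I : finType) (P : pred I) (A : I -> 'M[K]_(m, n))
    (B : 'M[K]_(p, q)) :
  (\sum_(i | P i) A i) *t B = \sum_(i | P i) A i *t B.
Proof.
by elim/big_rec2: _ => [|i y x _ <-]; rewrite ?tens0mx ?tensmxDl.
Qed.

Lemma tensmx_sumr m n p q (I : finType) (P : pred I) (A : 'M[K]_(m, n))
    (B : I -> 'M[K]_(p, q)) :
  A *t (\sum_(i | P i) B i) = \sum_(i | P i) A *t B i.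
Proof.
by elim/big_rec2: _ => [|i y x _ <-]; rewrite ?tensmx0 ?tensmxDr.
Qed.

Lemma tensmx11 m n : (1%:M : 'M[K]_m) *t (1%:M : 'M[K]_n) = 1%:M.
Proof.
apply/matrixP=> i j; case: (mxtens_indexP i) => i1 i2.
case: (mxtens_indexP j) => j1 j2; rewrite tensmxE !mxE -natrM mulnb.
by rewrite (inj_eq (can_inj (@mxtens_indexK _ _))).
Qed.

(* [1 * n] does not reduce to [n], hence the casts. *)
Definition tens_row (N n p : nat) (u : 'rV[K]_N) (A : 'M[K]_(n, p)) :
  'M[K]_(n, N * p) := castmx (mul1n n, erefl) (u *t A).

Definition tens_col (N n p : nat) (u : 'cV[K]_N) (A : 'M[K]_(n, p)) :
  'M[K]_(N * n, p) := castmx (erefl, mul1n p) (u *t A).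

Lemma cast_row_mul k n p q (e : k = n) (X : 'M[K]_(k, p)) (Y : 'M[K]_(p, q)) :
  castmx (e, erefl) X *m Y = castmx (e, erefl) (X *m Y).
Proof. by case: _ / e. Qed.

Lemma tens_rowM N n p N' p' (u : 'rV[K]_N) (A : 'M[K]_(n, p))
    (X : 'M[K]_(N, N')) (Y : 'M[K]_(p, p')) :
  tens_row u A *m (X *t Y) = tens_row (u *m X) (A *m Y).
Proof.
by rewrite /tens_row -tensmx_mul cast_row_mul.
Qed.

Lemma mul_tens_row N m n p (u : 'rV[K]_N) (A : 'M[K]_(n, p)) (B : 'M[K]_(m, n)) :
  B *m tens_row u A = tens_row u (B *m A).
Proof.
apply/matrixP => i j; case: (mxtens_indexP j) => j1 j2.
have tE k (D : 'M[K]_(k, p)) i' : tens_row u D i' (mxtens_index (j1, j2)) = u 0 j1 * D i' j2.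
  rewrite /tens_row castmxE cast_ord_id /= !mxE mxtens_indexK /=.
  congr (u _ _ * D _ _); first by apply: ord1.
  by apply: val_inj => /=; rewrite modn_small.
rewrite tE !mxE big_distrr /=; apply: eq_bigr => k _.
by rewrite tE mulrCA.
Qed.

Lemma tens_row_col N n p q (u : 'rV[K]_N) (A : 'M[K]_(n, p)) (v : 'cV[K]_N)
    (B : 'M[K]_(p, q)) :
  tens_row u A *m tens_col v B = (u *m v) 0 0 *: (A *m B).
Proof.
have -> : (u *m v) 0 0 *: (A *m B) =
    castmx (mul1n n, mul1n q) ((u *m v) *t (A *m B)).
  apply/matrixP => i j; rewrite castmxE !mxE.
  congr (_ * _); apply: eq_bigr => k _.
    by congr (u _ _ * v _ _); apply/esym/ord1.
  by congr (A _ _ * B _ _); apply: val_inj => /=; rewrite modn_small.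
rewrite -tensmx_mul /tens_row /tens_col cast_row_mul.
move: (u *t A) (v *t B) => U V.
have gen k l (e1 : k = n) (e2 : l = q) (W : 'M[K]_(k, N * p)) (W' : 'M_(_, l)) :
    castmx (e1, erefl) (W *m castmx (erefl, e2) W') = castmx (e1, e2) (W *m W').
  by case: _ / e1; case: _ / e2; rewrite !castmx_id.
exact: gen.
Qed.

Lemma eqmx_tens_row N n p (u : 'rV[K]_N) (A : 'M[K]_(n, p))
    (v : 'rV[K]_N) (B : 'M[K]_(n, p)) :
  (u *t A - v *t B :=: tens_row u A - tens_row v B)%MS.
Proof.
have gen k (e : k = n) (X Y : 'M[K]_(k, N * p)) :
    (X - Y :=: castmx (e, erefl) X - castmx (e, erefl) Y)%MS.
  by case: _ / e; rewrite !castmx_id.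
exact: gen.
Qed.

Lemma quot_map_eq0 m k n (U : 'M[K]_(m, n)) (A : 'M[K]_(k, n)) :
  (A *m quot_map U == 0) = (A <= U)%MS.
Proof.
rewrite submxE -[X in _ = (_ *m X == 0)]mulmx_base mulmxA /quot_map.
by rewrite [RHS]mulmx_free_eq0 ?row_base_free.
Qed.

Lemma quot_map_full m n (U : 'M[K]_(m, n)) : row_full (quot_map U).
Proof. exact: col_base_full. Qed.

(** Going to the quotient and back by [pinvmx] changes a vector only by an element of [U], which [P]
    kills. Well-definedness on quotients is reduced to this. *)
Lemma quot_mapK m n p (U : 'M[K]_(m, n)) (P : 'M[K]_(n, p)) :
  U *m P = 0 -> quot_map U *m pinvmx (quot_map U) *m P = P.
Proof.
move=> UP; apply/eqP; rewrite -subr_eq0 -[X in _ - X]mul1mx -mulmxBl.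
have: (quot_map U *m pinvmx (quot_map U) - 1%:M <= U)%MS.
  by rewrite -quot_map_eq0 mulmxBl -mulmxA mulVpmx ?quot_map_full // mulmx1 mul1mx subrr.
by case/submxP => D ->; rewrite -mulmxA UP mulmx0.
Qed.

(** In [E *m E = E], with [E = col_base E *m row_base E], the outer factors cancel by full rank. The
    image of [E] thus becomes a space of row vectors. *)
Lemma idempotent_split n (E : 'M[K]_n) : E *m E = E ->
  {rc : 'M[K]_(\rank E, n) * 'M[K]_(n, \rank E) |
    rc.1 *m rc.2 = 1%:M & rc.2 *m rc.1 = E}.
Proof.
move=> EE; exists (row_base E, col_base E); last exact: mulmx_base.
apply: (row_free_inj (row_base_free E)); rewrite /=.
have /row_fullP[D DC] := col_base_full E.
have H : col_base E *m (row_base E *m col_base E *m row_base E) = col_base E *m row_base E.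
  by rewrite mulmx_base -mulmxA mulmx_base mulmxA mulmx_base.
by move/(congr1 (mulmx D)): H; rewrite 2!(mulmxA D) DC !mul1mx.
Qed.

End LinearAlgebra.

(** * Categories of FI type *)

Section FITypeFacts.
Variables (C : category) (hC : FI_type C).

Lemma comp_inj (a b c : C) (f : Mor b c) : injective (@mcomp C a b c f).
Proof. by case: hC => mono _ g h; apply: mono. Qed.

Lemma endo_inverse (a : C) (f : Mor a a) :
  {g : Mor a a | mcomp g f = idm a /\ mcomp f g = idm a}.
Proof. by apply: cid; case: hC => _ [endo _]; apply: endo. Qed.

Definition einv (a : C) (f : Mor a a) : Mor a a := sval (endo_inverse f).

Lemma einvL (a : C) (f : Mor a a) : mcomp (einv f) f = idm a.
Proof. by rewrite /einv; case: endo_inverse => g []. Qed.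

Lemma einvR (a : C) (f : Mor a a) : mcomp f (einv f) = idm a.
Proof. by rewrite /einv; case: endo_inverse => g []. Qed.

Lemma compmK (a b : C) (f : Mor a a) : cancel (fun x : Mor a b => mcomp x f) (mcomp^~ (einv f)).
Proof. by move=> x; rewrite -Defs.compA einvR compm1. Qed.

Lemma compmVK (a b : C) (f : Mor a a) : cancel (fun x : Mor a b => mcomp x (einv f)) (mcomp^~ f).
Proof. by move=> x; rewrite -Defs.compA einvL compm1. Qed.

Lemma compKm (a b : C) (f : Mor b b) : cancel (fun x : Mor a b => mcomp f x) (mcomp (einv f)).
Proof. by move=> x; rewrite Defs.compA einvL comp1m. Qed.

Lemma compVKm (a b : C) (f : Mor b b) : cancel (fun x : Mor a b => mcomp (einv f) x) (mcomp f).
Proof. by move=> x; rewrite Defs.compA einvR comp1m. Qed.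

Lemma einvK (a : C) : involutive (@einv a).
Proof. by move=> f; rewrite -[LHS](compmVK f) einvL comp1m. Qed.

Lemma comp_eq_einv (a b : C) (x y : Mor a b) (g : Mor a a) :
  (mcomp x g == y) = (mcomp y (einv g) == x).
Proof. by apply/eqP/eqP => <-; rewrite ?compmK ?compmVK. Qed.

(** So [Mor a a] is the whole group G_a, and sums over G_a can run over [Mor a a]. *)
Lemma isAutT (a : C) (f : Mor a a) : isAut f.
Proof.
by apply/existsP; exists (einv f); rewrite einvL einvR !eqxx.
Qed.

Lemma hom_trans (c d : C) (f g : Mor c d) : exists s : Mor d d, mcomp s f = g.
Proof.
by case: hC => _ [_ [tr _]]; case: (tr c d f g) => s [_ E]; exists s.
Qed.

Lemma card_endo_gt0 (a : C) : (0 < #|Mor a a|)%N.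
Proof. by apply/card_gt0P; exists (idm a). Qed.

End FITypeFacts.
Arguments comp_inj {C} hC {a b c} f [x1 x2].

(** * Frames *)

(* For [M = (+)_i Ind_{c_i}(V_i)], [inc i f] is [v |-> f (x) v], and [prj i f]
   sends [f' (x) v] to the sum of the [g v] over the [g] with [f' = f g]. *)
Record frame (C : category) (K : fieldType) (M : cmod C K) (I : finType)
    (S : I -> summand C K) := Frame {
  inc : forall i d, Mor (sob (S i)) d -> 'M[K]_(sdim (S i), mdim M d);
  prj : forall i d, Mor (sob (S i)) d -> 'M[K]_(mdim M d, sdim (S i));
  inc_act : forall i d e (h : Mor d e) (f : Mor (sob (S i)) d),
    inc (mcomp h f) = inc f *m mact M h;
  inc_prj_neq : forall i j d (f : Mor (sob (S i)) d) (f' : Mor (sob (S j)) d),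
    i != j -> inc f *m prj f' = 0;
  inc_prj : forall i d (f f' : Mor (sob (S i)) d),
    inc f *m prj f' = \sum_(g | mcomp f' g == f) srep g;
  frame_sum : forall d,
    \sum_i \sum_(f : Mor (sob (S i)) d)
      #|Mor (sob (S i)) (sob (S i))|%:R^-1 *: (prj f *m inc f) = 1%:M
}.

Arguments inc {C K M I S} _ {i d} f.
Arguments prj {C K M I S} _ {i d} f.

(** * The frame of an induction module *)

Section IndFrame.
Variables (C : category) (hC : FI_type C) (K : fieldType).
Hypothesis charK : [pchar K] =i pred0.

Lemma card_endo_neq0 (a : C) : #|Mor a a|%:R != 0 :> K.
Proof. by rewrite (pcharf0P K).1 // -lt0n card_endo_gt0. Qed.

Variables (s : summand C K) (rep_s : is_rep s).
Local Notation c := (sob s).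
Local Notation n := (sdim s).

Lemma repM (g h : Mor c c) : srep (mcomp h g) = srep g *m srep h.
Proof. by case: rep_s => _ -> //; apply: isAutT. Qed.

(** The map v |-> f (x) v before passing to the quotient; [ind_coef] is likewise [prj] before the
    quotient. *)
Definition ind_gen (d : C) (f : Mor c d) : 'M[K]_(n, #|Mor c d| * n) :=
  tens_row (hvec K f) 1%:M.

Definition ind_coef (d : C) (f : Mor c d) : 'M[K]_(#|Mor c d| * n, n) :=
  \sum_(g : Mor c c) tens_col (hvec K (mcomp f g))^T (srep g).

Lemma hvecM (d : C) (f f' : Mor c d) :
  (hvec K f *m (hvec K f')^T) 0 0 = (f == f')%:R.
Proof.
rewrite /hvec trmx_delta mul_delta_mx_cond (inj_eq enum_rank_inj).
by case: eqP; rewrite ?mulr1n ?mulr0n !mxE.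
Qed.

Lemma ind_gen_coef (d : C) (f f' : Mor c d) :
  ind_gen f *m ind_coef f' = \sum_(g | mcomp f' g == f) srep g.
Proof.
rewrite /ind_coef mulmx_sumr [RHS]big_mkcond /=; apply: eq_bigr => g _.
rewrite tens_row_col hvecM mul1mx eq_sym.
by case: eqP; rewrite ?scale1r ?scale0r.
Qed.

Lemma ind_gen_sum (d : C) m (A B : 'M[K]_(#|Mor c d| * n, m)) :
  (forall f : Mor c d, ind_gen f *m A = ind_gen f *m B) -> A = B.
Proof.
move=> AB; apply/row_matrixP => i; case: (mxtens_indexP i) => j k.
have row_gen (D : 'M[K]_(#|Mor c d| * n, m)) :
    row (mxtens_index (j, k)) D = row k (ind_gen (enum_val j) *m D).
  rewrite !rowE mulmxA; congr (_ *m D).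
  rewrite mul_tens_row mulmx1; apply/rowP => l.
  case: (mxtens_indexP l) => l1 l2; rewrite /tens_row castmxE cast_ord_id !mxE.
  rewrite mxtens_indexK /= enum_valK -natrM mulnb.
  by rewrite (inj_eq (can_inj (@mxtens_indexK _ _))) xpair_eqE.
by rewrite !row_gen AB.
Qed.

Lemma hpush_hvec (d e : C) (h : Mor d e) (f : Mor c d) :
  hvec K f *m hpush K c h = hvec K (mcomp h f).
Proof.
apply/rowP => j; rewrite -rowE !mxE eqxx /= enum_rankK.
by rewrite -(inj_eq enum_rank_inj) enum_valK eq_sym.
Qed.

Lemma ind_rel_eq0 (d : C) m (A : 'M[K]_(#|Mor c d| * n, m)) :
  (forall (f : Mor c d) (g : Mor c c),
     ind_gen (mcomp f g) *m A = srep g *m (ind_gen f *m A)) ->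
  ind_rel s d *m A = 0.
Proof.
move=> HA; apply/sub_kermxP; apply/sumsmx_subP => f _; apply/sumsmx_subP => g _.
rewrite genmxE eqmx_tens_row; apply/sub_kermxP.
by rewrite mulmxBl HA mulmxA mul_tens_row mulmx1 subrr.
Qed.

Local Notation Q d := (quot_map (ind_rel s d)).

Lemma ind_genM (d : C) (f : Mor c d) (g : Mor c c) :
  ind_gen (mcomp f g) *m Q d = srep g *m (ind_gen f *m Q d).
Proof.
apply/eqP; rewrite -subr_eq0 mulmxA -mulmxBl quot_map_eq0 mul_tens_row mulmx1.
rewrite -eqmx_tens_row; apply: (sumsmx_sup f) => //.
by apply: (sumsmx_sup g); rewrite ?isAutT // genmxE.
Qed.

Lemma ind_coef_rel (d : C) (f : Mor c d) : ind_rel s d *m ind_coef f = 0.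
Proof.
apply: ind_rel_eq0 => f' g; rewrite !ind_gen_coef mulmx_sumr.
(* Substituting k g for k turns the condition f k = f' g into f k = f', as g cancels. *)
rewrite (reindex (fun k => mcomp k g)) /=; last first.
  exists (fun k => mcomp k (einv hC g)) => k _; [exact: compmK|exact: compmVK].
apply: eq_big => k; last by rewrite repM.
by rewrite Defs.compA (can_eq (compmK hC g)).
Qed.

Lemma ind_push_rel (d e : C) (h : Mor d e) :
  ind_rel s d *m (hpush K c h *t 1%:M *m Q e) = 0.
Proof.
have gen_push f : ind_gen f *m (hpush K c h *t 1%:M *m Q e) =
    ind_gen (mcomp h f) *m Q e.
  by rewrite mulmxA /ind_gen tens_rowM mulmx1 hpush_hvec.
by apply: ind_rel_eq0 => f g; rewrite !gen_push Defs.compA ind_genM.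
Qed.

Lemma ind_frame : frame (Ind s) (fun _ : unit => s).
Proof.
pose inc0 (_ : unit) d (f : Mor c d) : 'M[K]_(n, mdim (Ind s) d) := ind_gen f *m Q d.
pose prj0 (_ : unit) d (f : Mor c d) : 'M[K]_(mdim (Ind s) d, n) :=
  pinvmx (Q d) *m ind_coef f.
have incprj i j d (f f' : Mor c d) :
    inc0 i d f *m prj0 j d f' = \sum_(g | mcomp f' g == f) srep g.
  transitivity (ind_gen f *m (Q d *m pinvmx (Q d) *m ind_coef f')).
    by rewrite /inc0 /prj0 !mulmxA.
  by rewrite quot_mapK ?ind_coef_rel // ind_gen_coef.
apply: (@Frame _ _ _ _ _ inc0 prj0).
- move=> i d e h f.
  transitivity (ind_gen f *m (Q d *m pinvmx (Q d) *m (hpush K c h *t 1%:M *m Q e))).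
    rewrite quot_mapK ?ind_push_rel // [in RHS]mulmxA /ind_gen tens_rowM mulmx1.
    by rewrite hpush_hvec.
  by rewrite /inc0 /= /ind_act !mulmxA.
- by case; case.
- by move=> i d f f'; apply: incprj.
move=> d; rewrite (big_pred1 tt) /=; last by case.
(* As [Q d] is onto, the identity can be tested after [Q d], and there on the f (x) v. *)
have [D DQ] := row_fullP (quot_map_full (ind_rel s d)).
suff H : Q d *m (\sum_(f : Mor c d) #|Mor c c|%:R^-1 *: (prj0 tt d f *m inc0 tt d f)) = Q d.
  by rewrite -[LHS]mul1mx -DQ -mulmxA H.
apply: ind_gen_sum => f; rewrite mulmxA -/(inc0 tt d f) mulmx_sumr.
under eq_bigr => f' _ do rewrite -scalemxAr mulmxA incprj mulmx_suml.
rewrite -scaler_sumr.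
under eq_bigr => f' _ do under eq_bigr => g /eqP E do rewrite /inc0 -ind_genM E.
(* For each g exactly one f' satisfies f' g = f, namely f g^-1, so the sum is |G_c| copies of
   [inc0 tt d f]. *)
rewrite (exchange_big_dep xpredT) //= (eq_bigr (fun=> inc0 tt d f)) /=; last first.
  move=> g _; rewrite (big_pred1 (mcomp f (einv hC g))) // => f'.
  by rewrite comp_eq_einv eq_sym.
by rewrite sumr_const -scaler_nat scalerA mulVf ?scale1r // card_endo_neq0.
Qed.

End IndFrame.

(** * Computing with frames *)

Section FrameTheory.
Variables (C : category) (hC : FI_type C) (K : fieldType).
Variables (M : cmod C K) (I : finType) (S : I -> summand C K) (F : frame M S).

Lemma frame_expand d m (A : 'M[K]_(mdim M d, m)) :
  A = \sum_i \sum_(f : Mor (sob (S i)) d)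
        #|Mor (sob (S i)) (sob (S i))|%:R^-1 *: (prj F f *m (inc F f *m A)).
Proof.
rewrite -[LHS]mul1mx -(frame_sum F) mulmx_suml; apply: eq_bigr => i _.
by rewrite mulmx_suml; apply: eq_bigr => f _; rewrite -scalemxAl mulmxA.
Qed.

(** By [frame_expand] the images of the [inc F f] span M_d, so maps out of M_d can be compared on
    them. *)
Lemma frame_ext d m (A B : 'M[K]_(mdim M d, m)) :
  (forall i (f : Mor (sob (S i)) d), inc F f *m A = inc F f *m B) -> A = B.
Proof.
move=> AB; rewrite (frame_expand A) (frame_expand B).
by apply: eq_bigr => i _; apply: eq_bigr => f _; rewrite AB.
Qed.

(** A [cmod] carries no functor laws; a frame forces them, since [inc_act] yields them on a spanning
    set. *)
Lemma frame_act1 d : mact M (idm d) = 1%:M.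
Proof. by apply: frame_ext => i f; rewrite -inc_act comp1m mulmx1. Qed.

Lemma frame_actM a b c (h : Mor b c) (k : Mor a b) :
  mact M (mcomp h k) = mact M k *m mact M h.
Proof. by apply: frame_ext => i f; rewrite mulmxA -!inc_act Defs.compA. Qed.

Lemma inc_prj_comp i d e (h : Mor d e) (f f' : Mor (sob (S i)) d) :
  inc F (mcomp h f) *m prj F (mcomp h f') = inc F f *m prj F f'.
Proof.
rewrite !inc_prj; apply: eq_bigl => g.
by rewrite -Defs.compA (inj_eq (comp_inj hC _)).
Qed.

Lemma act_prj i d e (h : Mor d e) (f : Mor (sob (S i)) d) :
  mact M h *m prj F (mcomp h f) = prj F f.
Proof.
apply: frame_ext => j f'; rewrite mulmxA -inc_act.
have [ij|ij] := eqVneq j i; last by rewrite !inc_prj_neq.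
by subst j; rewrite inc_prj_comp.
Qed.

(** A nonzero term would give h f' = f g, hence f = h (f' g^-1). Together with [act_prj] this gives
    all coordinates of M(h). *)
Lemma act_prj0 i d e (h : Mor d e) (f : Mor (sob (S i)) e) :
  (forall f', mcomp h f' != f) -> mact M h *m prj F f = 0.
Proof.
move=> hf; apply: frame_ext => j f'; rewrite mulmx0 mulmxA -inc_act.
have [ij|ij] := eqVneq j i; last by rewrite !inc_prj_neq.
subst j; rewrite inc_prj big_pred0 // => g; apply/negbTE.
rewrite (comp_eq_einv hC) -Defs.compA; exact: hf.
Qed.

End FrameTheory.

(** * Modules with frames over the same family are isomorphic *)

Section FrameIso.
Variables (C : category) (hC : FI_type C) (K : fieldType).
Variables (I : finType) (S : I -> summand C K).

Definition frame_map (M N : cmod C K) (F : frame M S) (G : frame N S) (d : C) :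
    'M[K]_(mdim M d, mdim N d) :=
  \sum_i \sum_(f : Mor (sob (S i)) d)
    #|Mor (sob (S i)) (sob (S i))|%:R^-1 *: (prj F f *m inc G f).

(** By [inc_prj] the coordinates of f (x) v depend on the family [S] alone, so they agree in M and
    N. *)
Lemma inc_frame_map (M N : cmod C K) (F : frame M S) (G : frame N S) (d : C)
    i (f : Mor (sob (S i)) d) : inc F f *m frame_map F G d = inc G f.
Proof.
rewrite -[RHS]mulmx1 -(frame_sum G) !mulmx_sumr; apply: eq_bigr => j _.
rewrite !mulmx_sumr; apply: eq_bigr => f' _; rewrite -!scalemxAr !mulmxA.
congr (_ *: (_ *m _)).
have [ij|ij] := eqVneq i j; last by rewrite !inc_prj_neq.
by subst j; rewrite !inc_prj.
Qed.

Lemma frame_mapK (M N : cmod C K) (F : frame M S) (G : frame N S) (d : C) :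
  frame_map F G d *m frame_map G F d = 1%:M.
Proof.
by apply: (frame_ext (F := F)) => i f; rewrite mulmxA !inc_frame_map mulmx1.
Qed.

Lemma frame_mod_iso (M N : cmod C K) : frame M S -> frame N S -> mod_iso M N.
Proof.
move=> F G; exists (frame_map F G); split=> [c d f|d].
  apply: (frame_ext (F := F)) => i x; rewrite !mulmxA -inc_act.
  by rewrite !inc_frame_map inc_act.
apply/andP; split.
  by apply/row_freeP; exists (frame_map G F d); apply: frame_mapK.
by apply/row_fullP; exists (frame_map G F d); apply: frame_mapK.
Qed.

Lemma frame_reindex (M : cmod C K) (J : finType) (b : J -> I) :
  bijective b -> frame M S -> frame M (S \o b).
Proof.
move=> bij_b F.
apply: (@Frame _ _ M J (S \o b) (fun j d f => inc F f) (fun j d f => prj F f)).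
- by move=> j d e h f; apply: (inc_act F).
- by move=> i j d f f' ij; apply: (inc_prj_neq F); rewrite (inj_eq (bij_inj bij_b)).
- by move=> j d f f'; apply: (inc_prj F).
by move=> d; rewrite -(frame_sum F) [RHS](reindex b) //; apply: onW_bij.
Qed.

End FrameIso.

(** * Frames of free modules *)

Section FreeFrame.
Variables (C : category) (hC : FI_type C) (K : fieldType).

Lemma zero_frame (S : void -> summand C K) : frame (zero_mod C K) S.
Proof.
apply: (@Frame _ _ (zero_mod C K) _ S (fun i => match i with end) (fun i => match i with end)).
all: try by case.
by move=> d; apply/matrixP; case.
Qed.

Lemma dsum_frame (M N : cmod C K) (I J : finType) (S : I + J -> summand C K) :
  frame M (S \o inl) -> frame N (S \o inr) -> frame (dsum_mod M N) S.
Proof.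
move=> F G.
pose inc0 k d : Mor (sob (S k)) d -> 'M[K]_(sdim (S k), mdim (dsum_mod M N) d) :=
  match k with
  | inl i => fun f => row_mx (inc F (i := i) f) 0
  | inr j => fun f => row_mx 0 (inc G (i := j) f)
  end.
pose prj0 k d : Mor (sob (S k)) d -> 'M[K]_(mdim (dsum_mod M N) d, sdim (S k)) :=
  match k with
  | inl i => fun f => col_mx (prj F (i := i) f) 0
  | inr j => fun f => col_mx 0 (prj G (i := j) f)
  end.
apply: (@Frame _ _ (dsum_mod M N) _ S inc0 prj0).
- move=> [i|j] d e h f /=; rewrite mul_row_block !mulmx0 !mul0mx ?addr0 ?add0r.
    by rewrite (inc_act F).
  by rewrite (inc_act G).
- move=> [i|j] [i'|j'] d f f' ij /=; rewrite mul_row_col ?mulmx0 ?mul0mx ?addr0 ?add0r //.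
    by rewrite (inc_prj_neq F).
  by rewrite (inc_prj_neq G).
- move=> [i|j] d f f' /=; rewrite mul_row_col ?mulmx0 ?mul0mx ?addr0 ?add0r.
    by rewrite (inc_prj F).
  by rewrite (inc_prj G).
move=> d; rewrite big_sumType /= (scalar_mx_block (mdim M d) (mdim N d)) -(frame_sum F) -(frame_sum G).
have blockD (A : 'M[K]_(mdim M d)) (B : 'M[K]_(mdim N d)) :
    block_mx A 0 0 B = block_mx A 0 0 0 + block_mx 0 0 0 B.
  by rewrite add_block_mx !addr0 add0r.
have block_ul (X : finType) (A : X -> 'M[K]_(mdim M d)) :
    block_mx (\sum_x A x) 0 0 (0 : 'M_(mdim N d)) = \sum_x block_mx (A x) 0 0 0.
  apply: (big_morph (fun A => block_mx A 0 0 0)) => [B B'|]; last exact: block_mx0.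
  by rewrite add_block_mx !addr0.
have block_dr (X : finType) (A : X -> 'M[K]_(mdim N d)) :
    block_mx (0 : 'M_(mdim M d)) 0 0 (\sum_x A x) = \sum_x block_mx 0 0 0 (A x).
  apply: (big_morph (fun A => block_mx 0 0 0 A)) => [B B'|]; last exact: block_mx0.
  by rewrite add_block_mx !addr0.
rewrite blockD block_ul block_dr; congr (_ + _); apply: eq_bigr => k _.
  rewrite block_ul; apply: eq_bigr => f _.
  by rewrite mul_col_row !mul0mx !mulmx0 scale_block_mx !scaler0.
rewrite block_dr; apply: eq_bigr => f _.
by rewrite mul_col_row !mul0mx !mulmx0 scale_block_mx !scaler0.
Qed.

(** Nested sums unfold along the list as [free_mod] does along its direct sums, so [dsum_frame]
    applies directly. *)
Fixpoint idx (A : Type) (l : seq A) : finType :=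
  if l is _ :: l' then (unit + idx l')%type else void.

Fixpoint lookup (A : Type) (l : seq A) : idx l -> A :=
  match l with
  | [::] => fun k => match k with end
  | a :: l' => fun k => match k with inl _ => a | inr k' => lookup k' end
  end.

(** Listing the summands as [map S l] lets a free module and its dual have frames over the same
    index type. *)
Lemma free_mod_frame (A : Type) (S : A -> summand C K) (l : seq A) :
  [pchar K] =i pred0 -> (forall k : idx l, is_rep (S (lookup k))) ->
  frame (free_mod (map S l)) (fun k : idx l => S (lookup k)).
Proof.
move=> charK; elim: l => [|a l IHl] rep_S; first exact: zero_frame.
apply: dsum_frame; last by apply: IHl => k; apply: (rep_S (inr k)).
exact: (ind_frame hC charK (rep_S (inl tt))).
Qed.

Lemma lookup_mem (A : eqType) (l : seq A) (k : idx l) : lookup k \in l.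
Proof.
elim: l k => [[]|a l IHl] [u|k] /=; first exact: mem_head.
by rewrite in_cons IHl orbT.
Qed.

Lemma lookup_inj (A : eqType) (l : seq A) : uniq l -> injective (@lookup A l).
Proof.
elim: l => [_ []|a l IHl] /= /andP[al /IHl inj_l] [[]|k] [[]|k'] //= E.
- by rewrite E lookup_mem in al.
- by rewrite -E lookup_mem in al.
- by rewrite (inj_l _ _ E).
Qed.

Lemma card_idx (A : Type) (l : seq A) : #|idx l| = size l.
Proof. by elim: l => [|a l IHl]; rewrite /= ?card_void // card_sum card_unit IHl. Qed.

Lemma lookup_enum_bij (I : finType) : bijective (@lookup I (enum I)).
Proof.
apply: inj_card_bij; first exact/lookup_inj/enum_uniq.
by rewrite card_idx -cardE.
Qed.

Lemma Forall_lookup (A : Type) (P : A -> Prop) (l : seq A) :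
  List.Forall P l -> forall k : idx l, P (lookup k).
Proof. by elim=> [[]|a s Pa _ IH] [u|k] /=. Qed.

Lemma Forall_map_comp (A B : Type) (P : B -> Prop) (f : A -> B) (l : seq A) :
  List.Forall P (map f l) <-> List.Forall (P \o f) l.
Proof.
elim: l => [|a l IHl]; first by split=> _; constructor.
split=> H; constructor; first exact: List.Forall_inv H.
- by apply/IHl; apply: List.Forall_inv_tail H.
- exact: List.Forall_inv H.
- by apply/IHl; apply: List.Forall_inv_tail H.
Qed.

Lemma Forall_map_all (A B : Type) (P : B -> Prop) (f : A -> B) (l : seq A) :
  (forall a, P (f a)) -> List.Forall P (map f l).
Proof. by move=> Pf; elim: l => [|a l IHl]; constructor. Qed.

Lemma frame_free (M : cmod C K) (I : finType) (S : I -> summand C K) :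
  [pchar K] =i pred0 -> (forall i, is_rep (S i)) -> frame M S ->
  mod_iso (free_mod (map S (enum I))) M.
Proof.
move=> charK rep_S F.
apply: frame_mod_iso (frame_reindex (lookup_enum_bij I) F).
exact: free_mod_frame.
Qed.

End FreeFrame.

(** * Weak push-outs *)

Section JointCovers.
Variables (C : category) (hC : FI_type C).

Definition joint_cover (c1 c2 w : C) (a : Mor c1 w) (b : Mor c2 w) : Prop :=
  exists p (f1 : Mor p c1) (f2 : Mor p c2), is_weak_pushout f1 f2 a b.

(** In a category of FI type this is isomorphism of objects, by [eqv_inverse]. *)
Definition eqv (a b : C) : Prop := le_ob a b /\ le_ob b a.

Lemma eqv_sym a b : eqv a b -> eqv b a.
Proof. by case. Qed.

Lemma eqv_trans b a c : eqv a b -> eqv b c -> eqv a c.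
Proof.
case=> -[f] [f'] [[g] [g']].
by split; [exists; exact: mcomp g f | exists; exact: mcomp f' g'].
Qed.

Lemma pullback_comp (p c1 c2 d e : C) (f1 : Mor p c1) (f2 : Mor p c2)
    (g1 : Mor c1 d) (g2 : Mor c2 d) (h : Mor d e) :
  is_pullback f1 f2 (mcomp h g1) (mcomp h g2) <-> is_pullback f1 f2 g1 g2.
Proof.
split=> -[E uni]; split.
- by apply: (comp_inj hC h); rewrite !Defs.compA.
- by move=> z z1 z2 Ez; apply: uni; rewrite -!Defs.compA Ez.
- by rewrite -!Defs.compA E.
- by move=> z z1 z2 Ez; apply: uni; apply: (comp_inj hC h); rewrite !Defs.compA.
Qed.

Lemma pullback_precomp (p q c1 c2 d : C) (f1 : Mor p c1) (f2 : Mor p c2)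
    (g1 : Mor c1 d) (g2 : Mor c2 d) (i : Mor p q) (j : Mor q p) :
  mcomp i j = idm q -> mcomp j i = idm p ->
  is_pullback f1 f2 g1 g2 -> is_pullback (mcomp f1 j) (mcomp f2 j) g1 g2.
Proof.
move=> ij ji [E uni]; split; first by rewrite !Defs.compA E.
move=> z z1 z2 /uni[h [[E1 E2] _]]; exists (mcomp i h); split.
  by rewrite -!Defs.compA (Defs.compA j) ji comp1m.
move=> k [K1 _]; apply: (comp_inj hC (mcomp f1 j)).
by rewrite K1 -!Defs.compA (Defs.compA j) ji comp1m.
Qed.

(** Push out the pullback of x and y: their square is itself a pullback, so the universal property
    supplies h. *)
Lemma joint_cover_ex (c1 c2 d : C) (x : Mor c1 d) (y : Mor c2 d) :
  exists w (a : Mor c1 w) (b : Mor c2 w) (h : Mor w d),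
    [/\ joint_cover a b, mcomp h a = x & mcomp h b = y].
Proof.
case: hC => _ [_ [_ [_ [pb wpo]]]].
have [p [f1 [f2 pbp]]] := pb _ _ _ x y.
have [w [a [b wpo_w]]] := wpo _ _ _ f1 f2.
have [_ /(_ _ _ _ pbp)[h [[ha hb] _]]] := wpo_w.
by exists w, a, b, h; split=> //; exists p, f1, f2.
Qed.

(** As h and h' are monic, (a', b') has the same pullback as (a, b). The weak push-out gives s, and
    its uniqueness clause for (h a, h b) identifies h with h' s. *)
Lemma joint_cover_factor (c1 c2 w w' d : C) (a : Mor c1 w) (b : Mor c2 w)
    (a' : Mor c1 w') (b' : Mor c2 w') (h : Mor w d) (h' : Mor w' d) :
  joint_cover a b ->
  mcomp h a = mcomp h' a' -> mcomp h b = mcomp h' b' ->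
  exists s : Mor w w', h = mcomp h' s.
Proof.
move=> [p [f1 [f2 [pbw uni]]]] Ea Eb.
have pbh : is_pullback f1 f2 (mcomp h a) (mcomp h b) by apply/pullback_comp.
have pbw' : is_pullback f1 f2 a' b'.
  by apply/(pullback_comp _ _ _ _ h'); rewrite -Ea -Eb.
have [s [[sa sb] _]] := uni _ _ _ pbw'; exists s.
have [k [_ kuni]] := uni _ _ _ pbh.
by rewrite -(kuni h) // -(kuni (mcomp h' s)) // -!Defs.compA sa sb.
Qed.

(** The endomorphism v u is invertible, so (v u)^-1 v is a left inverse of u; being monic, it is a
    right inverse too. *)
Lemma eqv_inverse (w w' : C) (u : Mor w w') : le_ob w' w ->
  exists s : Mor w' w, mcomp s u = idm w /\ mcomp u s = idm w'.
Proof.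
case=> v; exists (mcomp (einv hC (mcomp v u)) v).
have su : mcomp (mcomp (einv hC (mcomp v u)) v) u = idm w.
  by rewrite -Defs.compA einvL.
split=> //; apply: (comp_inj hC (mcomp (einv hC (mcomp v u)) v)).
by rewrite Defs.compA su comp1m compm1.
Qed.

Lemma joint_cover_eqv (c1 c2 w w' : C) (a : Mor c1 w) (b : Mor c2 w) (u : Mor w w') :
  le_ob w' w -> joint_cover a b -> joint_cover (mcomp u a) (mcomp u b).
Proof.
move=> /(eqv_inverse u)[s [su us]] [p [f1 [f2 [pbw uni]]]].
exists p, f1, f2; split; first exact/pullback_comp.
move=> z h1 h2 /uni[k [[k1 k2] kuni]]; exists (mcomp k s); split.
  by rewrite -!Defs.compA !(Defs.compA s) su !comp1m.
move=> k' []; rewrite !Defs.compA => K1 K2.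
by rewrite (kuni (mcomp k' u)) // -Defs.compA us compm1.
Qed.

Lemma pullback_twist (p c1 c2 d : C) (f1 : Mor p c1) (f2 : Mor p c2)
    (g1 : Mor c1 d) (g2 : Mor c2 d) (k1 : Mor c1 c1) (k2 : Mor c2 c2) :
  is_pullback (mcomp k1 f1) (mcomp k2 f2) g1 g2 <->
  is_pullback f1 f2 (mcomp g1 k1) (mcomp g2 k2).
Proof.
split=> -[E uni]; split; rewrite ?Defs.compA -?Defs.compA //.
- move=> z z1 z2; rewrite -!Defs.compA => /uni[h [[H1 H2] huni]]; exists h; split.
    by split; [apply: (comp_inj hC k1)|apply: (comp_inj hC k2)]; rewrite Defs.compA.
  by move=> k [K1 K2]; apply: huni; rewrite -!Defs.compA K1 K2.
- by rewrite !Defs.compA.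
- move=> z z1 z2 Ez.
  have [|h [[H1 H2] huni]] := uni z (mcomp (einv hC k1) z1) (mcomp (einv hC k2) z2).
    by rewrite -!Defs.compA !compVKm.
  exists h; split; first by rewrite -!Defs.compA H1 H2 !compVKm.
  by move=> k [K1 K2]; apply: huni; rewrite -K1 -K2 -!Defs.compA !compKm.
Qed.

(** Automorphisms on the legs are moved to the span. Being a joint cover thus depends only on the
    orbit under precomposition with automorphisms of c1 and c2. *)
Lemma joint_cover_twist (c1 c2 w : C) (a : Mor c1 w) (b : Mor c2 w)
    (k1 : Mor c1 c1) (k2 : Mor c2 c2) :
  joint_cover (mcomp a k1) (mcomp b k2) -> joint_cover a b.
Proof.
move=> [p [f1 [f2 [pbw uni]]]]; exists p, (mcomp k1 f1), (mcomp k2 f2).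
split; first exact/pullback_twist.
move=> z h1 h2 /pullback_twist/uni[h [[H1 H2] huni]]; exists h; split.
  split; first by rewrite -(compmK hC k1 h1) -H1 Defs.compA compmK.
  by rewrite -(compmK hC k2 h2) -H2 Defs.compA compmK.
by move=> k [K1 K2]; apply: huni; rewrite !Defs.compA K1 K2.
Qed.

(** Up to isomorphism only finitely many p map to c1, each with finitely many spans to c1 and c2,
    and a span determines w up to isomorphism. *)
Lemma joint_cover_finite (c1 c2 : C) : exists (L : finType) (w : L -> C),
  forall (w' : C) (a : Mor c1 w') (b : Mor c2 w'), joint_cover a b ->
    exists l, eqv (w l) w'.
Proof.
case: hC => _ [_ [_ [fin [_ wpo]]]].
have [s cov_s] := fin c1.
pose span (k : 'I_(size s)) : finType := (Mor (nth c1 s k) c1 * Mor (nth c1 s k) c2)%type.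
pose L : finType := {k : 'I_(size s) & span k}.
pose po (l : L) := cid (wpo _ _ _ (tagged l).1 (tagged l).2).
exists L, (fun l => sval (po l)) => w' a b [p [f1 [f2 [pbw uni]]]].
have [q sq [i [j [ji ij]]]] := cov_s p (inhabits f1).
have [k ks Ek] : exists2 k, (k < size s)%N & nth c1 s k = q.
  elim: s sq {cov_s span L po} => //= x s IHs [->|/IHs[k ks Ek]]; first by exists 0%N.
  by exists k.+1.
move: i j ji ij; rewrite -Ek => i j ji ij.
(* The span (f1, f2) is precomposed with the isomorphism j from the listed representative of p. *)
exists (existT (fun k => span k) (Ordinal ks) (mcomp f1 j, mcomp f2 j)).
case: (po _) => w /= [g1 [g2 [pbg unig]]]; split.
  have [h _] := unig _ _ _ (pullback_precomp ij ji pbw).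
  by exists; exact: h.
have := pullback_precomp ji ij pbg.
rewrite -!Defs.compA ji !compm1 => /uni[h _].
by exists; exact: h.
Qed.

(** [pick] returns the same element for predicates that agree, so [r] selects one representative per
    class; the new index set consists of the fixed points of [r]. *)
Lemma eqv_transversal (L : finType) (w : L -> C) :
  exists (L' : finType) (w' : L' -> C),
    (forall l l', eqv (w' l) (w' l') -> l = l') /\
    (forall l, exists l', eqv (w' l') (w l)).
Proof.
pose r l := odflt l [pick l' | `[< eqv (w l') (w l) >]].
have rP l : eqv (w (r l)) (w l).
  rewrite /r; case: pickP => [l' /asboolP //|_] /=.
  by split; exists; exact: idm.
have rE l l' : eqv (w l) (w l') -> r l = r l'.
  move=> ll'; rewrite /r (@eq_pick _ _ (fun k => `[< eqv (w k) (w l') >])).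
    case: pickP => //= no; have /asboolP[] := negbT (no l').
    by split; exists; exact: idm.
  move=> k /=; apply: asbool_equiv_eq; split=> [E|E].
    exact: eqv_trans E ll'.
  exact: eqv_trans E (eqv_sym ll').
exists {l | r l == l}, (fun l => w (sval l)); split=> [[l rl] [l' rl'] /rE|l].
  by rewrite /= (eqP rl) (eqP rl') => E; apply: val_inj.
have rr : r (r l) == r l by apply/eqP/rE/rP.
by exists (exist _ (r l) rr) => /=.
Qed.

Lemma joint_cover_transversal (I J : finType) (c : I -> C) (e : J -> C) :
  exists (L : finType) (w : L -> C),
    (forall l l', eqv (w l) (w l') -> l = l') /\
    (forall i j (w' : C) (a : Mor (c i) w') (b : Mor (e j) w'), joint_cover a b ->
       exists l, eqv (w l) w').
Proof.
pose cov i j := cid (joint_cover_finite (c i) (e j)).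
pose L0 : finType := {ij : I * J & sval (cov ij.1 ij.2)}.
pose w0 (l : L0) : C := sval (cid (svalP (cov (tag l).1 (tag l).2))) (tagged l).
have [L [w [w_inj w_cov]]] := eqv_transversal w0.
exists L, w; split=> // i j w' a b ab.
have [l0 El0] := svalP (cid (svalP (cov i j))) w' a b ab.
have [l El] := w_cov (existT (fun ij : I * J => sval (cov ij.1 ij.2) : Type) (i, j) l0).
exists l; exact: eqv_trans El El0.
Qed.

(** Let w' be a weak push-out of the span prolonged by c1 -> e1 and c2 -> e2. These maps are monic,
    so the composites c1 -> w' and c2 -> w' still have pullback p, whence w -> w' -> d. *)
Lemma joint_cover_le (c1 c2 e1 e2 w d : C) (a : Mor c1 w) (b : Mor c2 w) :
  joint_cover a b -> le_ob c1 e1 -> le_ob c2 e2 -> geq_sum e1 e2 d -> le_ob w d.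
Proof.
move=> [p [f1 [f2 [pbw uni]]]] [x] [y] ge_d.
case: (hC) => _ [_ [_ [_ [_ wpo]]]].
have [w' [g1 [g2 wpo_w']]] := wpo _ _ _ (mcomp x f1) (mcomp y f2).
have [v] := ge_d _ _ _ _ _ _ wpo_w'.
case: wpo_w' => -[E univ] _.
have pbxy : is_pullback f1 f2 (mcomp g1 x) (mcomp g2 y).
  split; first by rewrite -!Defs.compA.
  move=> z z1 z2; rewrite -!Defs.compA => /univ[h [[H1 H2] huni]].
  exists h; split.
    by split; [apply: (comp_inj hC x)|apply: (comp_inj hC y)]; rewrite Defs.compA.
  by move=> k [K1 K2]; apply: huni; rewrite -!Defs.compA K1 K2.
have [h _] := uni _ _ _ pbxy.
by exists; exact: mcomp v h.
Qed.

End JointCovers.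

(** * Tensor products *)

Section Regroup.
Variables (C : category) (hC : FI_type C) (K : fieldType).
Hypothesis charK : [pchar K] =i pred0.
Variable M : cmod C K.
Hypothesis act1 : forall d, mact M (idm d) = 1%:M.
Hypothesis actM : forall (a b c : C) (h : Mor b c) (k : Mor a b),
  mact M (mcomp h k) = mact M k *m mact M h.

(** A frame with functors [X i] in place of Hom-functors. For M (x) N these are Hom(c_i, -) x
    Hom(c_j, -), and [xeq] says that two pairs differ by automorphisms of c_i and c_j. *)
Variables (I : finType) (X : I -> C -> finType).
Variable xact : forall i d e, Mor d e -> X i d -> X i e.
Variable xeq : forall i d, rel (X i d).
Variables (n : I -> nat) (wt : I -> K).
Variable xinc : forall i d, X i d -> 'M[K]_(n i, mdim M d).
Variable xprj : forall i d, X i d -> 'M[K]_(mdim M d, n i).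
Hypothesis xact1 : forall i d (x : X i d), xact (idm d) x = x.
Hypothesis xactM : forall i a b c (h : Mor b c) (k : Mor a b) (x : X i a),
  xact (mcomp h k) x = xact h (xact k x).
Hypothesis xact_inj : forall i d e (h : Mor d e), injective (@xact i d e h).
Hypothesis xeqxx : forall i d (x : X i d), xeq x x.
Hypothesis xinc_act : forall i d e (h : Mor d e) (x : X i d),
  xinc (xact h x) = xinc x *m mact M h.
Hypothesis xinc_prj_neq : forall i j d (x : X i d) (y : X j d),
  i != j -> xinc x *m xprj y = 0.
Hypothesis xinc_prj0 : forall i d (x y : X i d),
  ~~ xeq x y -> xinc x *m xprj y = 0.
Hypothesis xinc_prj_comp : forall i d e (h : Mor d e) (x y : X i d),
  xinc (xact h x) *m xprj (xact h y) = xinc x *m xprj y.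
Hypothesis xframe_sum : forall d,
  \sum_i \sum_(x : X i d) wt i *: (xprj x *m xinc x) = 1%:M.

(* The functor [X i] is the disjoint union of the [Hom(w l, -)] over the
   [Aut(w l)]-orbits of generators in [X i (w l)]. *)
Variables (L : finType) (w : L -> C) (gen : forall i l, pred (X i (w l))).
Hypothesis gen_xeq : forall i l (a b : X i (w l)), xeq a b -> gen a -> gen b.
Hypothesis gen_act : forall i l (s : Mor (w l) (w l)) (a : X i (w l)),
  gen a -> gen (xact s a).
Hypothesis gen_inj : forall i l l' d (h : Mor (w l) d) (h' : Mor (w l') d)
    (a : X i (w l)) (a' : X i (w l')),
  gen a -> gen a' -> xeq (xact h a) (xact h' a') -> l = l'.
Hypothesis gen_factor : forall i l d (h h' : Mor (w l) d) (a a' : X i (w l)),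
  gen a -> gen a' -> xeq (xact h a) (xact h' a') -> exists s, h = mcomp h' s.
Hypothesis gen_ex : forall i d (x : X i d),
  exists l (h : Mor (w l) d) (a : X i (w l)), gen a /\ xact h a = x.

(** The terms of [xframe_sum] at generators form the projection onto the span of their [xinc];
    [gen_coef h] undoes M(h) on that span. *)
Definition gen_proj l : 'M[K]_(mdim M (w l)) :=
  \sum_i \sum_(a : X i (w l) | gen a) wt i *: (xprj a *m xinc a).

Definition gen_coef l d (h : Mor (w l) d) : 'M[K]_(mdim M d, mdim M (w l)) :=
  \sum_i \sum_(a : X i (w l) | gen a) wt i *: (xprj (xact h a) *m xinc a).

(** By [gen_xeq] no non-generator is [xeq]-related to a, so [xinc a] kills the other terms of
    [xframe_sum]. *)
Lemma xinc_gen_proj i l (a : X i (w l)) : gen a -> xinc a *m gen_proj l = xinc a.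
Proof.
move=> gen_a; rewrite -[RHS]mulmx1 -(xframe_sum (w l)) !mulmx_sumr.
apply: eq_bigr => j _; rewrite !mulmx_sumr [LHS]big_mkcond; apply: eq_bigr => b _.
rewrite -!scalemxAr !mulmxA; case: ifPn => // gen_b.
have [ij|ij] := eqVneq i j; last by rewrite xinc_prj_neq // mul0mx scaler0.
subst j; rewrite xinc_prj0 ?mul0mx ?scaler0 //.
by apply: contra gen_b => /gen_xeq; apply.
Qed.

Lemma gen_proj_idem l : gen_proj l *m gen_proj l = gen_proj l.
Proof.
rewrite {1 3}/gen_proj mulmx_suml; apply: eq_bigr => i _.
rewrite mulmx_suml; apply: eq_bigr => a gen_a.
by rewrite -scalemxAl -mulmxA xinc_gen_proj.
Qed.

Lemma gen_proj_act l (s : Mor (w l) (w l)) :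
  gen_proj l *m mact M s *m gen_proj l = gen_proj l *m mact M s.
Proof.
rewrite {1 3}/gen_proj !mulmx_suml; apply: eq_bigr => i _.
rewrite !mulmx_suml; apply: eq_bigr => a gen_a.
by rewrite -!scalemxAl -!mulmxA (mulmxA (xinc a)) -xinc_act xinc_gen_proj ?gen_act.
Qed.

Lemma gen_coef_proj l d (h : Mor (w l) d) : gen_coef h *m gen_proj l = gen_coef h.
Proof.
rewrite {1 2}/gen_coef mulmx_suml; apply: eq_bigr => i _.
rewrite mulmx_suml; apply: eq_bigr => a gen_a.
by rewrite -scalemxAl -mulmxA xinc_gen_proj.
Qed.

Lemma act_gen_coef i l d (h : Mor (w l) d) (b : X i (w l)) :
  xinc b *m mact M h *m gen_coef h = xinc b *m gen_proj l.
Proof.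
rewrite !mulmx_sumr; apply: eq_bigr => j _.
rewrite !mulmx_sumr; apply: eq_bigr => a _.
rewrite -!scalemxAr !mulmxA -xinc_act; congr (_ *: (_ *m _)).
have [ij|ij] := eqVneq i j; last by rewrite !xinc_prj_neq.
by subst j; rewrite xinc_prj_comp.
Qed.

Lemma gen_proj_coef l (s : Mor (w l) (w l)) d (h : Mor (w l) d) :
  gen_proj l *m mact M (mcomp h s) *m gen_coef h = gen_proj l *m mact M s.
Proof.
rewrite -[RHS]gen_proj_act actM {1 2}/gen_proj !mulmx_suml; apply: eq_bigr => i _.
rewrite !mulmx_suml; apply: eq_bigr => a _; rewrite -!scalemxAl -!mulmxA.
by rewrite !(mulmxA (xinc a)) -xinc_act (mulmxA (xinc _)) act_gen_coef.
Qed.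

Lemma gen_proj_coef0 l l' d (h : Mor (w l) d) (h' : Mor (w l') d) :
  (forall i (a : X i (w l)) (a' : X i (w l')), gen a -> gen a' ->
     ~~ xeq (xact h a) (xact h' a')) ->
  gen_proj l *m mact M h *m gen_coef h' = 0.
Proof.
move=> sep; rewrite /gen_proj !mulmx_suml big1 // => i _.
rewrite !mulmx_suml big1 // => a gen_a; rewrite -!scalemxAl -!mulmxA.
rewrite (mulmxA (xinc a)) -xinc_act /gen_coef mulmx_sumr big1 ?mulmx0 ?scaler0 // => j _.
rewrite mulmx_sumr big1 // => a' gen_a'; rewrite -scalemxAr mulmxA.
have [ij|ij] := eqVneq i j; last by rewrite xinc_prj_neq // mul0mx scaler0.
by subst j; rewrite xinc_prj0 ?mul0mx ?scaler0 // sep.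
Qed.

(** If x = h0 a0, the pairs (h, a) with a generator a and h a = x are the (h0 s, s^-1 a0) with s in
    Aut(w l0), so x is counted |Aut(w l0)| times. *)
Lemma gen_count (V : lmodType K) i d (x : X i d) (v : V) :
  \sum_l #|Mor (w l) (w l)|%:R^-1 *:
    (\sum_(h : Mor (w l) d) \sum_(a | gen a && (xact h a == x)) v) = v.
Proof.
have [l0 [h0 [a0 [gen_a0 h0a0]]]] := gen_ex x.
rewrite (bigD1 l0) //= [X in _ + X]big1 ?addr0; last first.
  move=> l ll0; rewrite big1 ?scaler0 // => h _; rewrite big_pred0 // => a.
  apply/negP => /andP[gen_a /eqP ha]; case/eqP: ll0.
  by apply: (gen_inj (h := h) (h' := h0) gen_a gen_a0); rewrite ha h0a0.
rewrite (eq_bigr (fun h => \sum_(s | mcomp h0 s == h) v)) => [|h _]; last first.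
  have [/existsP[s /eqP Eh]|] := boolP [exists s, mcomp h0 s == h].
    rewrite (big_pred1 (xact (einv hC s) a0)) => [|a].
      by rewrite (big_pred1 s) // => s'; rewrite -Eh (inj_eq (comp_inj hC h0)).
    rewrite -Eh xactM -h0a0 (inj_eq (@xact_inj _ _ _ h0)) /=.
    apply/andP/eqP => [[_ /eqP <-]|->]; first by rewrite -xactM einvL xact1.
    by rewrite -xactM einvR xact1 eqxx gen_act.
  rewrite negb_exists => /forallP no_s.
  rewrite big_pred0 => [|a]; last first.
    apply/negP => /andP[gen_a /eqP ha].
    have [|s Eh] := gen_factor (h := h) (h' := h0) gen_a gen_a0; first by rewrite ha h0a0.
    by have := no_s s; rewrite -Eh eqxx.
  by rewrite big_pred0 // => s; apply: negbTE.
rewrite (exchange_big_dep xpredT) //= (eq_bigr (fun=> v)) => [|s _]; last first.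
  by rewrite (big_pred1 (mcomp h0 s)) // => h; rewrite eq_sym.
by rewrite sumr_const -scaler_nat scalerA mulVf ?scale1r // card_endo_neq0.
Qed.

Definition gen_row l := (s2val (idempotent_split (gen_proj_idem l))).1.
Definition gen_col l := (s2val (idempotent_split (gen_proj_idem l))).2.

Lemma gen_row_col l : gen_row l *m gen_col l = 1%:M.
Proof. exact: (s2valP (idempotent_split (gen_proj_idem l))). Qed.

Lemma gen_col_row l : gen_col l *m gen_row l = gen_proj l.
Proof. exact: (s2valP' (idempotent_split (gen_proj_idem l))). Qed.

Lemma gen_row_proj l : gen_row l *m gen_proj l = gen_row l.
Proof. by rewrite -[X in _ *m X]gen_col_row mulmxA gen_row_col mul1mx. Qed.

Definition gen_summand l : summand C K :=
  @Summand C K (w l) (\rank (gen_proj l))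
    (fun g => gen_row l *m mact M g *m gen_col l).

Lemma gen_summand_rep l : is_rep (gen_summand l).
Proof.
split=> [|g h _ _] /=; first by rewrite act1 mulmx1 gen_row_col.
rewrite actM !mulmxA; congr (_ *m _).
rewrite -(mulmxA _ (gen_col _)) gen_col_row; congr (_ *m _).
by rewrite -gen_row_proj -!mulmxA (mulmxA (gen_proj l)) gen_proj_act.
Qed.

(** If every generator had n i = 0, each term of [gen_proj] would factor through a zero space. This
    ties degrees to actual pairs of legs. *)
Lemma gen_summand_dim l : (0 < sdim (gen_summand l))%N ->
  exists i (a : X i (w l)), gen a /\ (0 < n i)%N.
Proof.
move=> /= rk; apply: contrapT => no; move: rk.
rewrite /gen_proj big1 ?mxrank0 // => i _; rewrite big1 // => a gen_a.
have n0 : n i = 0%N.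
  by apply/eqP; rewrite -leqn0 leqNgt; apply/negP => ni; apply: no; exists i, a.
move: (xprj a) (xinc a); rewrite n0 => A B.
by rewrite (thinmx0 A) mul0mx scaler0.
Qed.

Lemma regroup_frame : frame M gen_summand.
Proof.
pose inc0 l d (h : Mor (w l) d) : 'M[K]_(\rank (gen_proj l), mdim M d) :=
  gen_row l *m mact M h.
pose prj0 l d (h : Mor (w l) d) : 'M[K]_(mdim M d, \rank (gen_proj l)) :=
  gen_coef h *m gen_col l.
have inc_prj l l' d (h : Mor (w l) d) (h' : Mor (w l') d) : inc0 l d h *m prj0 l' d h' =
    gen_row l *m (gen_proj l *m mact M h *m gen_coef h') *m gen_col l'.
  by rewrite /inc0 /prj0 !mulmxA gen_row_proj.
apply: (@Frame _ _ M L gen_summand inc0 prj0).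
- by move=> l d e h f; rewrite /inc0 actM mulmxA.
- move=> l l' d h h' ll'; rewrite inc_prj gen_proj_coef0 ?mulmx0 ?mul0mx //.
  move=> i a a' gen_a gen_a'; apply: contraNN ll' => E.
  by rewrite (gen_inj gen_a gen_a' E).
- move=> l d h h'; rewrite inc_prj.
  (* A factor s with h = h' s is unique, as h' is monic; if there is none, [gen_factor] excludes
     related generators and the product is 0. *)
  have [/existsP[s /eqP Eh]|] := boolP [exists s, mcomp h' s == h].
    rewrite (big_pred1 s) => [|s']; last by rewrite -Eh (inj_eq (comp_inj hC h')).
    by rewrite -Eh gen_proj_coef mulmxA gen_row_proj.
  rewrite negb_exists => /forallP no_s.
  rewrite big_pred0 => [|s]; last exact: negbTE.
  rewrite gen_proj_coef0 ?mulmx0 ?mul0mx // => i a a' gen_a gen_a'.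
  apply/negP => /(gen_factor gen_a gen_a')[s Eh].
  by have := no_s s; rewrite Eh eqxx.
move=> d; rewrite -(xframe_sum d).
pose Q i (x : X i d) := wt i *: (xprj x *m xinc x).
(* By [gen_count] the term at x is spread over the pairs (h, a) that represent x. *)
transitivity (\sum_l \sum_i \sum_x #|Mor (w l) (w l)|%:R^-1 *:
   (\sum_(h : Mor (w l) d) \sum_(a | gen a && (xact h a == x)) Q i x)).
  apply: eq_bigr => l _; rewrite -scaler_sumr.
  under [RHS]eq_bigr => i _ do rewrite -scaler_sumr exchange_big.
  rewrite -scaler_sumr exchange_big; congr (_ *: _); apply: eq_bigr => h _ /=.
  transitivity (gen_coef h *m mact M h).
    by rewrite /inc0 /prj0 mulmxA -(mulmxA _ (gen_col _)) gen_col_row gen_coef_proj.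
  rewrite /gen_coef mulmx_suml; apply: eq_bigr => i _; rewrite mulmx_suml.
  rewrite [RHS](exchange_big_dep (@gen i l)) /=; last by move=> x a _ /andP[].
  apply: eq_bigr => a gen_a; rewrite (big_pred1 (xact h a)) => [|x]; last by rewrite gen_a eq_sym.
  by rewrite /Q -scalemxAl -mulmxA xinc_act.
rewrite exchange_big; apply: eq_bigr => i _; rewrite exchange_big.
by apply: eq_bigr => x _; rewrite gen_count.
Qed.

End Regroup.

(** * The frame of a tensor product and its degree *)

Section TensorFrame.
Variables (C : category) (hC : FI_type C) (K : fieldType).
Hypothesis charK : [pchar K] =i pred0.
Variables (M N : cmod C K) (I J : finType).
Variables (S : I -> summand C K) (T : J -> summand C K).
Variables (F : frame M S) (G : frame N T).

Definition pair_hom (ij : I * J) (d : C) : finType :=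
  (Mor (sob (S ij.1)) d * Mor (sob (T ij.2)) d)%type.

Definition pair_act ij d e (h : Mor d e) (x : pair_hom ij d) : pair_hom ij e :=
  (mcomp h x.1, mcomp h x.2).

Definition pair_eq ij d : rel (pair_hom ij d) := fun x y =>
  [exists g1, mcomp y.1 g1 == x.1] && [exists g2, mcomp y.2 g2 == x.2].

Definition pair_inc ij d (x : pair_hom ij d) :
    'M[K]_(sdim (S ij.1) * sdim (T ij.2), mdim (tens_mod M N) d) :=
  inc F x.1 *t inc G x.2.

Definition pair_prj ij d (x : pair_hom ij d) :
    'M[K]_(mdim (tens_mod M N) d, sdim (S ij.1) * sdim (T ij.2)) :=
  prj F x.1 *t prj G x.2.

Definition pair_wt (ij : I * J) : K :=
  #|Mor (sob (S ij.1)) (sob (S ij.1))|%:R^-1 *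
  #|Mor (sob (T ij.2)) (sob (T ij.2))|%:R^-1.

Lemma pair_inc_prj ij kl d (x : pair_hom ij d) (y : pair_hom kl d) :
  pair_inc x *m pair_prj y = (inc F x.1 *m prj F y.1) *t (inc G x.2 *m prj G y.2).
Proof. by rewrite /pair_inc /pair_prj tensmx_mul. Qed.

Lemma pair_inc_prj0 ij d (x y : pair_hom ij d) :
  ~~ pair_eq x y -> pair_inc x *m pair_prj y = 0.
Proof.
rewrite pair_inc_prj !inc_prj negb_and !negb_exists.
case/orP => /forallP no_g.
  by rewrite [X in X *t _]big_pred0 ?tens0mx // => g; apply: negbTE.
by rewrite [X in _ *t X]big_pred0 ?tensmx0 // => g; apply: negbTE.
Qed.

Lemma pair_frame_sum d :
  \sum_ij \sum_(x : pair_hom ij d) pair_wt ij *: (pair_prj x *m pair_inc x) = 1%:M.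
Proof.
rewrite -tensmx11 -(frame_sum F) -(frame_sum G) tensmx_suml.
rewrite -(pair_big xpredT xpredT (fun i j => \sum_(x : pair_hom (i, j) d)
   pair_wt (i, j) *: (pair_prj x *m pair_inc x))) /=.
apply: eq_bigr => i _; rewrite tensmx_sumr; apply: eq_bigr => j _.
rewrite -(pair_big xpredT xpredT (fun a b => pair_wt (i, j) *:
   (pair_prj ((a, b) : pair_hom (i, j) d) *m pair_inc ((a, b) : pair_hom (i, j) d)))) /=.
rewrite tensmx_suml; apply: eq_bigr => a _; rewrite tensmx_sumr; apply: eq_bigr => b _.
by rewrite tensmxZ /pair_inc /pair_prj tensmx_mul.
Qed.

Lemma tens_frame : exists (L : finType) (U : L -> summand C K),
  [/\ forall l, is_rep (U l), inhabited (frame (tens_mod M N) U) &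
   forall e1 e2 d,
     (forall i, (0 < sdim (S i))%N -> le_ob (sob (S i)) e1) ->
     (forall j, (0 < sdim (T j))%N -> le_ob (sob (T j)) e2) ->
     geq_sum e1 e2 d ->
     forall l, (0 < sdim (U l))%N -> le_ob (sob (U l)) d].
Proof.
have [L [w [w_inj w_cov]]] :=
  joint_cover_transversal hC (fun i => sob (S i)) (fun j => sob (T j)).
pose gen ij l (x : pair_hom ij (w l)) := `[< joint_cover x.1 x.2 >].
have act1 d : mact (tens_mod M N) (idm d) = 1%:M.
  by rewrite /= (frame_act1 F) (frame_act1 G) tensmx11.
have actM a b c (h : Mor b c) (k : Mor a b) : mact (tens_mod M N) (mcomp h k) =
    mact (tens_mod M N) k *m mact (tens_mod M N) h.
  by rewrite /= (frame_actM F) (frame_actM G) tensmx_mul.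
have xact1 ij d (x : pair_hom ij d) : pair_act (idm d) x = x.
  by case: x => a b; rewrite /pair_act !comp1m.
have xactM ij a b c (h : Mor b c) (k : Mor a b) (x : pair_hom ij a) :
    pair_act (mcomp h k) x = pair_act h (pair_act k x).
  by rewrite /pair_act !Defs.compA.
have xact_inj ij d e (h : Mor d e) : injective (@pair_act ij d e h).
  by move=> [a b] [a' b'] [/(comp_inj hC)-> /(comp_inj hC)->].
have xeqxx ij d (x : pair_hom ij d) : pair_eq x x.
  by apply/andP; split; apply/existsP; exists (idm _); rewrite compm1.
have xinc_act ij d e (h : Mor d e) (x : pair_hom ij d) :
    pair_inc (pair_act h x) = pair_inc x *m mact (tens_mod M N) h.
  by rewrite /pair_inc !inc_act -tensmx_mul.
have xinc_prj_neq ij kl d (x : pair_hom ij d) (y : pair_hom kl d) :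
    ij != kl -> pair_inc x *m pair_prj y = 0.
  case: ij kl x y => [i j] [k l] x y; rewrite xpair_eqE negb_and pair_inc_prj.
  by case/orP => E; [rewrite (inc_prj_neq F) // tens0mx | rewrite (inc_prj_neq G) // tensmx0].
have xinc_prj_comp ij d e (h : Mor d e) (x y : pair_hom ij d) :
    pair_inc (pair_act h x) *m pair_prj (pair_act h y) = pair_inc x *m pair_prj y.
  by rewrite !pair_inc_prj !inc_prj_comp.
have gen_act ij l (s : Mor (w l) (w l)) (a : pair_hom ij (w l)) :
    gen ij l a -> gen ij l (pair_act s a).
  move=> /asboolP Ha; apply/asboolP; apply: (joint_cover_eqv hC _ _ Ha).
  exact: (inhabits (idm _)).
have gen_xeq ij l (a b : pair_hom ij (w l)) : pair_eq a b -> gen ij l a -> gen ij l b.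
  case: a b => [a1 a2] [b1 b2] /andP[/existsP[g1 /eqP /= <-] /existsP[g2 /eqP /= <-]].
  by move=> /asboolP Ha; apply/asboolP; apply: joint_cover_twist Ha.
have factor ij l l' d (h : Mor (w l) d) (h' : Mor (w l') d) a a' :
    gen ij l a -> pair_eq (pair_act h a) (pair_act h' a') -> exists s, h = mcomp h' s.
  move=> /asboolP Ha /andP[/existsP[g1 /eqP E1] /existsP[g2 /eqP E2]].
  apply: (joint_cover_factor hC Ha (a' := mcomp a'.1 g1) (b' := mcomp a'.2 g2));
  by rewrite Defs.compA.
have pair_eqC ij d (x y : pair_hom ij d) : pair_eq x y -> pair_eq y x.
  move=> /andP[/existsP[g1 /eqP E1] /existsP[g2 /eqP E2]]; apply/andP.
  split; apply/existsP; [exists (einv hC g1)|exists (einv hC g2)].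
    by rewrite -E1 compmK.
  by rewrite -E2 compmK.
have gen_inj ij l l' d (h : Mor (w l) d) (h' : Mor (w l') d) a a' :
    gen ij l a -> gen ij l' a' -> pair_eq (pair_act h a) (pair_act h' a') -> l = l'.
  move=> gen_a gen_a' E; apply: w_inj.
  have [s _] := factor _ _ _ _ _ _ _ _ gen_a E.
  have [s' _] := factor _ _ _ _ _ _ _ _ gen_a' (pair_eqC _ _ _ _ E).
  by split; [exact: (inhabits s) | exact: (inhabits s')].
have gen_factor ij l d (h h' : Mor (w l) d) a a' :
    gen ij l a -> gen ij l a' -> pair_eq (pair_act h a) (pair_act h' a') ->
    exists s, h = mcomp h' s.
  by move=> gen_a _; apply: factor.
have gen_ex ij d (x : pair_hom ij d) :
    exists l (h : Mor (w l) d) a, gen ij l a /\ pair_act h a = x.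
  case: x => x y; have [w' [a [b [h [ab ha hb]]]]] := joint_cover_ex hC x y.
  have [l [[v] lw]] := w_cov _ _ _ _ _ ab.
  (* The vertex w' is replaced by its representative [w l] along the isomorphism u. *)
  case: lw => u; have [s [su us]] := eqv_inverse hC u (inhabits v).
  exists l, (mcomp h s), (mcomp u a, mcomp u b); split.
    by apply/asboolP; apply: (joint_cover_eqv hC _ _ ab); exact: (inhabits v).
  by rewrite /pair_act /= -!Defs.compA !(Defs.compA s) su !comp1m ha hb.
have xinc_prj0 := pair_inc_prj0; have xsum := pair_frame_sum.
pose U := gen_summand xinc_prj_neq xinc_prj0 xsum gen_xeq.
exists L, U; split.
- move=> l; apply: gen_summand_rep => //.
- by exists; apply: regroup_frame.
(* A summand of positive dimension comes from legs with V_i and V_j both nonzero, so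
   [joint_cover_le] bounds its vertex. *)
move=> e1 e2 d dS dT ge_d l /gen_summand_dim[[i j] [[a b] [/asboolP ab]]].
rewrite muln_gt0 => /andP[/dS i1 /dT j2].
exact: (joint_cover_le hC ab i1 j2 ge_d).
Qed.

End TensorFrame.

(** * Duals *)

Section BilinearForms.
Variable K : fieldType.

(** The bilinear form with matrix P as a linear form on the tensor product, in the layout used by
    [pairing]. *)
Definition form_col m n (P : 'M[K]_(m, n)) : 'cV[K]_(m * n) :=
  \col_k P (mxtens_unindex k).1 (mxtens_unindex k).2.

Lemma tens_form_col m n m' n' (A : 'M[K]_(m, m')) (B : 'M[K]_(n, n'))
    (P : 'M[K]_(m', n')) :
  (A *t B) *m form_col P = form_col (A *m P *m B^T).
Proof.
apply/colP => k; case: (mxtens_indexP k) => i j; rewrite !mxE mxtens_indexK /=.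
rewrite (reindex (@mxtens_index m' n')) /=; last first.
  by exists (@mxtens_unindex m' n') => x _; rewrite ?mxtens_indexK ?mxtens_unindexK.
rewrite (eq_bigr (fun p => A i p.1 * P p.1 p.2 * B j p.2)); last first.
  by move=> [p q] _; rewrite !mxE !mxtens_indexK /= mulrAC.
rewrite -(pair_big xpredT xpredT (fun p q => A i p * P p q * B j q)) exchange_big /=.
by apply: eq_bigr => q _; rewrite !mxE big_distrl.
Qed.

Lemma pairing_form m n (P : 'M[K]_(m, n)) (x : 'rV[K]_m) (y : 'rV[K]_n) :
  pairing (form_col P) x y = (x *m P *m y^T) 0 0.
Proof.
rewrite /pairing exchange_big /= mxE; apply: eq_bigr => j _.
rewrite !mxE big_distrl; apply: eq_bigr => i _.
by rewrite !mxE mxtens_indexK /= mulrAC.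
Qed.

Lemma pairing_form0l m n (P : 'M[K]_(m, n)) (x : 'rV[K]_m) :
  (forall y, pairing (form_col P) x y = 0) -> x *m P = 0.
Proof.
move=> H; apply/rowP => j; have := H (delta_mx 0 j).
by rewrite pairing_form trmx_delta -colE !mxE.
Qed.

Lemma pairing_form0r m n (P : 'M[K]_(m, n)) (y : 'rV[K]_n) :
  (forall x, pairing (form_col P) x y = 0) -> P *m y^T = 0.
Proof.
move=> H; apply/colP => i; have := H (delta_mx 0 i).
by rewrite pairing_form -mulmxA -rowE !mxE.
Qed.

End BilinearForms.

Section Dual.
Variables (C : category) (hC : FI_type C) (K : fieldType).

Lemma srep_einv (s : summand C K) (g : Mor (sob s) (sob s)) :
  is_rep s -> srep (einv hC g) = invmx (srep g).
Proof.
move=> rep_s; have gV : srep g *m srep (einv hC g) = 1%:M.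
  by rewrite -(repM hC rep_s) einvL; case: rep_s.
have [ug _] := mulmx1_unit gV.
by rewrite -[LHS]mul1mx -(mulVmx ug) -mulmxA gV mulmx1.
Qed.

Lemma dual_rep (s : summand C K) : is_rep s -> is_rep (dual_summand s).
Proof.
move=> rep_s; split=> [|g h _ _] /=; first by case: rep_s => -> _; rewrite invmx1 trmx1.
rewrite -!srep_einv // -trmx_mul -(repM hC rep_s); congr (srep _)^T.
apply: (comp_inj hC (mcomp h g)).
by rewrite einvR -Defs.compA (Defs.compA g) einvR comp1m einvR.
Qed.

Variables (M M' : cmod C K) (I : finType) (S : I -> summand C K).
Hypothesis rep_S : forall i, is_rep (S i).
Variables (F : frame M S) (G : frame M' (fun i => dual_summand (S i))).

(** Substitute g^-1 for g: f = f' g^-1 means f' = f g, and the dual representation at g^-1 is the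
    transpose of the original at g. *)
Lemma dual_inc_prj i j d (f : Mor (sob (S i)) d) (f' : Mor (sob (S j)) d) :
  inc G (i := i) f *m prj G (i := j) f' = (inc F f' *m prj F f)^T.
Proof.
have [ij|ij] := eqVneq i j; last first.
  by rewrite (inc_prj_neq G) // inc_prj_neq ?trmx0 // eq_sym.
subst j; rewrite (inc_prj G) inc_prj raddf_sum /=.
rewrite (reindex_inj (can_inj (@einvK _ hC _))) /=; apply: eq_big => g; last first.
  by rewrite srep_einv // invmxK.
by rewrite comp_eq_einv einvK.
Qed.

Definition dual_form d : 'M[K]_(mdim M' d, mdim M d) :=
  \sum_i \sum_(f : Mor (sob (S i)) d)
    #|Mor (sob (S i)) (sob (S i))|%:R^-1 *: (prj G (i := i) f *m (prj F f)^T).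

Definition dual_coform d : 'M[K]_(mdim M d, mdim M' d) :=
  \sum_i \sum_(f : Mor (sob (S i)) d)
    #|Mor (sob (S i)) (sob (S i))|%:R^-1 *: ((inc F f)^T *m inc G (i := i) f).

(** After [dual_inc_prj] this is the transposed frame expansion of [prj F f]. *)
Lemma inc_dual_form i d (f : Mor (sob (S i)) d) :
  inc G (i := i) f *m dual_form d = (prj F f)^T.
Proof.
rewrite [in RHS](frame_expand F (prj F f)) [LHS]mulmx_sumr [RHS]raddf_sum; apply: eq_bigr => j _.
rewrite [LHS]mulmx_sumr [RHS]raddf_sum; apply: eq_bigr => f' _.
by rewrite [RHS]linearZ /= trmx_mul -dual_inc_prj -scalemxAr mulmxA.
Qed.

Lemma dual_form_inc i d (f : Mor (sob (S i)) d) :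
  dual_form d *m (inc F f)^T = prj G (i := i) f.
Proof.
rewrite [RHS](frame_expand G) mulmx_suml; apply: eq_bigr => j _.
rewrite mulmx_suml; apply: eq_bigr => f' _.
by rewrite -scalemxAl -mulmxA -trmx_mul dual_inc_prj.
Qed.

Lemma dual_formK d : dual_form d *m dual_coform d = 1%:M.
Proof.
apply: (frame_ext (F := G)) => i f; rewrite mulmxA inc_dual_form.
rewrite -(frame_sum G) !mulmx_sumr; apply: eq_bigr => j _.
rewrite !mulmx_sumr; apply: eq_bigr => f' _.
by rewrite -!scalemxAr !mulmxA -trmx_mul dual_inc_prj.
Qed.

Lemma dual_coformK d : dual_coform d *m dual_form d = 1%:M.
Proof.
apply: trmx_inj; rewrite trmx1; apply: (frame_ext (F := F)) => i f.
apply: trmx_inj; rewrite mulmx1 trmx_mul trmxK -mulmxA dual_form_inc.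
rewrite -[in RHS](mulmx1 (inc F f)) -(frame_sum F) mulmx_suml mulmx_sumr raddf_sum.
apply: eq_bigr => j _; rewrite mulmx_suml mulmx_sumr raddf_sum; apply: eq_bigr => f' _.
by rewrite -[in RHS]scalemxAr [RHS]linearZ /= -scalemxAl -mulmxA dual_inc_prj -trmx_mul mulmxA.
Qed.

(** On generators this is the transpose of [act_prj]. It yields both the homomorphism to the
    constant module and the G_d-invariance. *)
Lemma dual_form_act d e (h : Mor d e) :
  mact M' h *m dual_form e *m (mact M h)^T = dual_form d.
Proof.
apply: (frame_ext (F := G)) => i f; rewrite !mulmxA -(inc_act G) !inc_dual_form.
by rewrite -trmx_mul; congr _^T; apply: (act_prj hC F).
Qed.

Lemma dual_pairing : exists Phi : forall d, 'M[K]_(mdim (tens_mod M' M) d, 1),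
  is_mhom (tens_mod M' M) (const_mod C K) Phi /\
  forall d : C,
    (forall x : 'rV_(mdim M' d), (forall y : 'rV_(mdim M d), pairing (Phi d) x y = 0) -> x = 0) /\
    (forall y : 'rV_(mdim M d), (forall x : 'rV_(mdim M' d), pairing (Phi d) x y = 0) -> y = 0) /\
    (forall g : Mor d d, isAut g -> forall (x : 'rV_(mdim M' d)) (y : 'rV_(mdim M d)),
       pairing (Phi d) (x *m mact M' g) (y *m mact M g) = pairing (Phi d) x y).
Proof.
exists (fun d => form_col (dual_form d)); split=> [c d f|d].
  by rewrite /= mulmx1 tens_form_col dual_form_act.
split; [|split].
- by move=> x /pairing_form0l E; rewrite -[x]mulmx1 -dual_formK mulmxA E mul0mx.
- move=> y /pairing_form0r E; apply: trmx_inj.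
  by rewrite trmx0 -[LHS]mul1mx -dual_coformK -mulmxA E mulmx0.
move=> g _ x y; rewrite !pairing_form -[in RHS](dual_form_act g) trmx_mul.
by rewrite !mulmxA.
Qed.

End Dual.

(** * Coinvariants *)

Section Coinvariants.
Variables (C : category) (hC : FI_type C) (K : fieldType).
Hypothesis charK : [pchar K] =i pred0.
Variables (M : cmod C K) (I : finType) (S : I -> summand C K) (F : frame M S).

Lemma sub_coinv_rel d (g : Mor d d) : (1%:M - mact M g <= coinv_rel M d)%MS.
Proof. by apply: (sumsmx_sup g); rewrite ?isAutT // genmxE. Qed.

Lemma coinv_rel_eq0 d m (A : 'M[K]_(mdim M d, m)) :
  (forall g : Mor d d, mact M g *m A = A) -> coinv_rel M d *m A = 0.
Proof.
move=> HA; apply/sub_kermxP; apply/sumsmx_subP => g _.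
by rewrite genmxE; apply/sub_kermxP; rewrite mulmxBl mul1mx HA subrr.
Qed.

(** If Hom(c_i, d) is empty, so is the sum, and the average is 0. *)
Definition inc_avg i d : 'M[K]_(sdim (S i), mdim M d) :=
  #|Mor (sob (S i)) d|%:R^-1 *: \sum_(f : Mor (sob (S i)) d) inc F f.

Definition avg_proj e d : 'M[K]_(mdim M e, mdim M d) :=
  \sum_i \sum_(f : Mor (sob (S i)) e)
    #|Mor (sob (S i)) (sob (S i))|%:R^-1 *: (prj F f *m inc_avg i d).

(** h embeds Hom(c_i, d) into Hom(c_i, e), and coordinates outside the image vanish after M(h). *)
Lemma act_sum_prj i d e (h : Mor d e) :
  mact M h *m (\sum_(f : Mor (sob (S i)) e) prj F f) =
  \sum_(f : Mor (sob (S i)) d) prj F f.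
Proof.
rewrite mulmx_sumr (eq_bigr (fun f => \sum_(f' | mcomp h f' == f) prj F f')).
  rewrite (exchange_big_dep xpredT) //=; apply: eq_bigr => f _.
  by rewrite (big_pred1 (mcomp h f)) // => f'; rewrite eq_sym.
move=> f _; have [/existsP[f' /eqP <-]|] := boolP [exists f', mcomp h f' == f].
  rewrite (act_prj hC) (big_pred1 f') // => f''.
  by rewrite (inj_eq (comp_inj hC h)).
rewrite negb_exists => /forallP no_f.
by rewrite (act_prj0 hC) // big_pred0 // => f'; apply: negbTE.
Qed.

Lemma act_avg_proj d e a (h : Mor d e) : mact M h *m avg_proj e a = avg_proj d a.
Proof.
rewrite mulmx_sumr; apply: eq_bigr => i _.
by rewrite -!scaler_sumr -!mulmx_suml -scalemxAr mulmxA act_sum_prj.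
Qed.

(** By transitivity every h f' is a G_e-translate of f, hence congruent to it; one then averages
    over f'. *)
Lemma inc_sub_avg i d e (h : Mor d e) (f : Mor (sob (S i)) e) :
  ((0 < sdim (S i))%N -> le_ob (sob (S i)) d) ->
  (inc F f - inc_avg i d *m mact M h <= coinv_rel M e)%MS.
Proof.
move=> le_d; case: (posnP (sdim (S i))) => [n0|/le_d[f0]].
  by move: (_ - _); rewrite n0 => A; rewrite (flatmx0 A) sub0mx.
have card0 : #|Mor (sob (S i)) d|%:R != 0 :> K.
  by rewrite (pcharf0P K).1 // -lt0n; apply/card_gt0P; exists f0.
have -> : inc F f = #|Mor (sob (S i)) d|%:R^-1 *: \sum_(f' : Mor (sob (S i)) d) inc F f.
  by rewrite sumr_const -scaler_nat scalerA mulVf ?scale1r.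
rewrite -scalemxAl -scalerBr mulmx_suml -sumrB scalemx_sub // summx_sub // => f' _.
have [s Es] := hom_trans hC f (mcomp h f').
rewrite -inc_act -Es inc_act -{1}[inc F f]mulmx1 -mulmxBr.
exact/mulmx_sub/sub_coinv_rel.
Qed.

(** With h the identity this treats the composite on M_d/G_d; with d -> e, the one on M_e/G_e. *)
Lemma sub_avg_proj d e (h : Mor d e) :
  (forall i, (0 < sdim (S i))%N -> le_ob (sob (S i)) e -> le_ob (sob (S i)) d) ->
  (1%:M - avg_proj e d *m mact M h <= coinv_rel M e)%MS.
Proof.
move=> le_d; rewrite -(frame_sum F) mulmx_suml -sumrB summx_sub // => i _.
rewrite mulmx_suml -sumrB summx_sub // => f _.
rewrite -scalemxAl -scalerBr -mulmxA -mulmxBr scalemx_sub // mulmx_sub //.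
by apply: inc_sub_avg => /le_d; apply; exists.
Qed.

Lemma coinv_map_bij d e (h : Mor d e) :
  (forall i, (0 < sdim (S i))%N -> le_ob (sob (S i)) d) ->
  row_free (coinv_map M h) && row_full (coinv_map M h).
Proof.
move=> le_d; set Qd := quot_map (coinv_rel M d); set Qe := quot_map (coinv_rel M e).
have QD : Qd *m coinv_map M h = mact M h *m Qe.
  transitivity (Qd *m pinvmx Qd *m (mact M h *m Qe)); first by rewrite !mulmxA.
  rewrite quot_mapK //.
  (* By transitivity h g = s h with s in G_e, and s acts trivially on the coinvariants of M_e. *)
  apply: coinv_rel_eq0 => g; have [s Es] : exists s, mcomp s h = mcomp h g by apply: hom_trans.
  apply/eqP; rewrite mulmxA -(frame_actM F) -Es (frame_actM F) -subr_eq0 -mulmxBl.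
  rewrite -oppr_eq0 -mulNmx opprB -{1}[mact M h]mulmx1 -mulmxBr.
  by rewrite quot_map_eq0 mulmx_sub ?sub_coinv_rel.
(* The inverse; [avg_proj e d] descends to coinvariants because [act_avg_proj] makes it
   G_e-invariant. *)
pose Z := pinvmx Qe *m avg_proj e d *m Qd.
have QZ : Qe *m Z = avg_proj e d *m Qd.
  transitivity (Qe *m pinvmx Qe *m (avg_proj e d *m Qd)); first by rewrite !mulmxA.
  rewrite quot_mapK //.
  by apply: coinv_rel_eq0 => g; rewrite mulmxA act_avg_proj.
apply/andP; split.
  apply/row_freeP; exists Z.
  have [D DQ] := row_fullP (quot_map_full (coinv_rel M d)).
  rewrite -[LHS]mul1mx -DQ -mulmxA (mulmxA Qd) QD -(mulmxA _ Qe) QZ (mulmxA (mact M h)) act_avg_proj.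
  congr (D *m _); apply/esym/eqP; rewrite -subr_eq0 -/Qd -{1}[Qd]mul1mx -mulmxBl quot_map_eq0.
  by have := @sub_avg_proj d d (idm d); rewrite (frame_act1 F) mulmx1; apply.
apply/row_fullP; exists Z.
have [D DQ] := row_fullP (quot_map_full (coinv_rel M e)).
rewrite -[LHS]mul1mx -DQ -mulmxA (mulmxA Qe) QZ -(mulmxA _ Qd) QD (mulmxA (avg_proj e d)).
congr (D *m _); apply/esym/eqP; rewrite -subr_eq0 -/Qe -{1}[Qe]mul1mx -mulmxBl quot_map_eq0.
by apply: sub_avg_proj => i n0 _; apply: le_d.
Qed.

End Coinvariants.

(** * Tensor products, duals and coinvariants of free modules over the complex numbers *)

Theorem theoremB (R : realType) (C : category) (hC : FI_type C) :
  (* (1) tensor products of free modules are free, with degree <= c1 + c2 *)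
  (forall F1 F2 : seq (summand C R[i]), reps F1 -> reps F2 ->
     (exists F3 : seq (summand C R[i]), reps F3 /\
        mod_iso (free_mod F3) (tens_mod (free_mod F1) (free_mod F2))) /\
     (forall c1 c2 : C, deg_le F1 c1 -> deg_le F2 c2 ->
        exists F3 : seq (summand C R[i]), reps F3 /\
          mod_iso (free_mod F3) (tens_mod (free_mod F1) (free_mod F2)) /\
          deg_le_sum F3 c1 c2)) /\
  (* (2) duals *)
  (forall F : seq (summand C R[i]), reps F ->
     reps (dual_free F) /\
     (forall d : C, deg_le (dual_free F) d <-> deg_le F d) /\
     exists Phi : forall d : C,
         'M[R[i]]_(mdim (tens_mod (free_mod (dual_free F)) (free_mod F)) d, 1),
       is_mhom (tens_mod (free_mod (dual_free F)) (free_mod F)) (const_mod C R[i]) Phi /\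
       forall d : C,
         (forall x : 'rV_(mdim (free_mod (dual_free F)) d),
            (forall y : 'rV_(mdim (free_mod F) d), pairing (Phi d) x y = 0) -> x = 0) /\
         (forall y : 'rV_(mdim (free_mod F) d),
            (forall x : 'rV_(mdim (free_mod (dual_free F)) d), pairing (Phi d) x y = 0) -> y = 0) /\
         (forall g : Mor d d, isAut g ->
            forall (x : 'rV_(mdim (free_mod (dual_free F)) d)) (y : 'rV_(mdim (free_mod F) d)),
              pairing (Phi d) (x *m mact (free_mod (dual_free F)) g)
                              (y *m mact (free_mod F) g) = pairing (Phi d) x y)) /\
  (* (3) stability of coinvariants *)
  (forall (F : seq (summand C R[i])) (c : C), reps F -> deg_le F c ->
     forall d e : C, le_ob c d -> le_ob d e -> forall h : Mor d e,
       row_free (coinv_map (free_mod F) h) && row_full (coinv_map (free_mod F) h)).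
Proof.
have charC : [pchar R[i]] =i pred0 by apply: Num.Theory.pchar_num.
have frame_of (F : seq (summand C R[i])) : reps F ->
    frame (free_mod F) (fun k : idx F => lookup k).
  move=> /Forall_lookup repF.
  by have := @free_mod_frame C hC R[i] _ id F charC repF; rewrite map_id.
have degP (F : seq (summand C R[i])) c : deg_le F c ->
    forall k : idx F, (0 < sdim (lookup k))%N -> le_ob (sob (lookup k)) c.
  exact: Forall_lookup.
split; [|split].
- move=> F1 F2 rep1 rep2.
  have [L [U [repU [frU] degU]]] := tens_frame hC charC (frame_of _ rep1) (frame_of _ rep2).
  pose F3 := map U (enum L).
  have rep3 : reps F3 by apply: Forall_map_all.
  have iso3 : mod_iso (free_mod F3) (tens_mod (free_mod F1) (free_mod F2)).
    exact: frame_free.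
  split=> [|c1 c2 deg1 deg2]; exists F3; do !split=> //.
  move=> d ge_d; apply: Forall_map_all => l.
  exact: (degU c1 c2 d (degP _ _ deg1) (degP _ _ deg2) ge_d).
- move=> F repF; have repF' := Forall_lookup repF; split; [|split].
  + by elim: repF => [|s F' rep_s _ IH]; constructor; first exact: dual_rep.
  + by move=> d; apply: Forall_map_comp.
  apply: (dual_pairing hC repF' (frame_of _ repF)).
  apply: (@free_mod_frame C hC R[i] _ (@dual_summand C R[i]) F charC) => k.
  exact: dual_rep.
move=> F c repF degF d e [cd] _ h.
(* Each c_i with V_i nonzero satisfies c_i <= c <= d. *)
apply: (coinv_map_bij hC charC (frame_of _ repF)) => k /(degP _ _ degF)[f].
by exists; exact: mcomp cd f.
Qed.
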